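(* Assume the standing setup below and additionally that every $\ell\in\mathcal{F}$ is $L$-Lipschitz: $\ell(z')-\ell(z)\le L\,d(z,z')$ for all $z,z'\in\mathcal{Z}$. Let $\hat\ell\in\arg\min_{\ell\in\mathcal{F}}R_{\mathbb{P}_N,\alpha,2}(\ell)$ and assume $R^*_{\mathbb{P},\alpha,2}(\mathcal{F})=\inf_{\ell\in\mathcal{F}}R_{\mathbb{P},\alpha,2}(\ell)$ is attained by some $\ell^*\in\mathcal{F}$. Then for every $\eta\in(0,1)$, with probability at least $1-\eta$, $$R_{\mathbb{P},\alpha,2}(\hat\ell)-R^*_{\mathbb{P},\alpha,2}(\mathcal{F})\le\frac{48\,\mathcal{J}(\mathcal{F})}{\sqrt N}+\frac{48\,L\,[\mathrm{diam}(\mathcal{Z})]^2}{\alpha\sqrt N}+3B\sqrt{\frac{\log(2/\eta)}{2N}}.$$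
   Context: Standing setup: $(\mathcal{Z},d)$ is a Polish metric space with finite diameter $\mathrm{diam}(\mathcal{Z})=\sup_{z,z'}d(z,z')<\infty$. $\mathcal{F}$ is a class of upper semicontinuous functions $\ell:\mathcal{Z}\to[0,B]$, $B<\infty$ (the paper's statement is written for $B=1$, the sum-of-squares pairwise ranking loss), and all suprema over $\mathcal{F}$ are assumed measurable. $z_1,\dots,z_N$ are i.i.d. with law $\mathbb{P}$ and $\mathbb{P}_N=\frac1N\sum_i\delta_{z_i}$. The $2$-Wasserstein distance is $\mathcal{W}_2(\mathbb{P},\mathbb{Q})=\big(\inf_{\gamma\in\Gamma(\mathbb{P},\mathbb{Q})}\int d(z,z')^2d\gamma\big)^{1/2}$; $\mathfrak{W}^\alpha_2(\mathbb{P})=\{\mathbb{Q}:\mathcal{W}_2(\mathbb{P},\mathbb{Q})\le\alpha\}$ with $\alpha>0$; $R_{\mathbb{P},\alpha,2}(\ell)=\sup_{\mathbb{Q}\in\mathfrak{W}^\alpha_2(\mathbb{P})}\int\ell\,d\mathbb{Q}$ (likewise for $\mathbb{P}_N$). Dudley's entropy integral is $\mathcal{J}(\mathcal{F})=\int_0^\infty\sqrt{\log\mathfrak{N}(\mathcal{F},\|\cdot\|_\infty,\upsilon)}\,d\upsilon$, with $\mathfrak{N}(\mathcal{F},\|\cdot\|_\infty,\upsilon)$ the minimal size of a $\upsilon$-cover of $\mathcal{F}$ in the uniform norm by elements of $\mathcal{F}$; assume $\mathcal{J}(\mathcal{F})<\infty$. *)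

(* Defs.v *)
From HB Require Import structures.
From mathcomp Require Import all_boot all_order all_algebra.
From mathcomp Require Import all_classical all_reals all_analysis.
Set Implicit Arguments. Unset Strict Implicit. Unset Printing Implicit Defensive.
Import Order.TTheory GRing.Theory Num.Theory.
Local Open Scope classical_set_scope.
Local Open Scope ring_scope.

Section Defs.
Context {R : realType}.

Definition metric_axioms (Z : Type) (d : Z -> Z -> R) : Prop :=
  (forall x y, 0 <= d x y) /\
  (forall x y, d x y = 0 <-> x = y) /\
  (forall x y, d x y = d y x) /\
  (forall x y z, d x z <= d x y + d y z).

Definition d_open (Z : Type) (d : Z -> Z -> R) (A : set Z) : Prop :=
  forall x, A x -> exists2 e : R, 0 < e & forall y, d x y < e -> A y.

Definition d_complete (Z : Type) (d : Z -> Z -> R) : Prop :=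
  forall u : nat -> Z,
    (forall e : R, 0 < e -> exists M : nat, forall m n, (M <= m)%N -> (M <= n)%N ->
        d (u m) (u n) < e) ->
    exists x, forall e : R, 0 < e -> exists M : nat, forall n, (M <= n)%N -> d (u n) x < e.

Definition d_separable (Z : Type) (d : Z -> Z -> R) : Prop :=
  exists S : set Z, countable S /\
    forall x (e : R), 0 < e -> exists2 y, S y & d x y < e.

Definition polish_metric (Z : Type) (d : Z -> Z -> R) : Prop :=
  metric_axioms d /\ d_complete d /\ d_separable d.

Definition finite_diam (Z : Type) (d : Z -> Z -> R) : Prop :=
  exists M : R, forall x y, d x y <= M.

Definition diam (Z : Type) (d : Z -> Z -> R) : R :=
  sup [set d p.1 p.2 | p in [set: Z * Z]].

Definition usc (Z : Type) (d : Z -> Z -> R) (f : Z -> R) : Prop :=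
  forall x (c : R), f x < c -> exists2 e : R, 0 < e & forall y, d x y < e -> f y < c.

Section Wass.
Context {dZ : measure_display} {Z : measurableType dZ}.
Variable d : Z -> Z -> R.

Definition couplings (mu nu : set Z -> \bar R) : set (probability (Z * Z)%type R) :=
  [set g | forall A, measurable A ->
     g (A `*` [set: Z]) = mu A /\ g ([set: Z] `*` A) = nu A].

Definition W2sq (mu nu : set Z -> \bar R) : \bar R :=
  ereal_inf [set (\int[g]_p ((d p.1 p.2) ^+ 2)%:E)%E | g in couplings mu nu].

(* Wasserstein ball  { Q : W_2(mu,Q) <= alpha }, alpha > 0,
   written as W_2(mu,Q)^2 <= alpha^2 *)
Definition W2ball (mu : set Z -> \bar R) (alpha : R) : set (probability Z R) :=
  [set Q | (W2sq mu Q <= (alpha ^+ 2)%:E)%E].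

Definition dro_risk (mu : set Z -> \bar R) (alpha : R) (l : Z -> R) : \bar R :=
  ereal_sup [set (\int[Q]_z (l z)%:E)%E | Q in W2ball mu alpha].

Definition empirical (N : nat) (x : 'I_N -> Z) : set Z -> \bar R :=
  fun A => ((N%:R)^-1 * \sum_(i < N) \1_A (x i))%:E.
End Wass.

Section Dudley.
Variable Z : Type.

Definition has_cover (F : set (Z -> R)) (v : R) (n : nat) : Prop :=
  exists c : 'I_n -> (Z -> R), (forall i, F (c i)) /\
    forall l, F l -> exists i, forall x, `|l x - c i x| <= v.

(* minimal size of a v-cover (+oo if none is finite) *)
Definition covering_number (F : set (Z -> R)) (v : R) : \bar R :=
  ereal_inf [set (n%:R)%:E | n in [set n : nat | has_cover F v n]].

Definition entropy_integrand (F : set (Z -> R)) (v : R) : \bar R :=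
  match covering_number F v with
  | EFin r => (Num.sqrt (ln r))%:E
  | _ => +oo%E
  end.

Definition dudley_integral (F : set (Z -> R)) : \bar R :=
  (\int[@lebesgue_measure R]_(v in [set v : R | (0 < v)%R]) entropy_integrand F v)%E.
End Dudley.

Definition iid_sample {dO : measure_display} {Om : measurableType dO}
  {dZ : measure_display} {Z : measurableType dZ}
  (Pr : probability Om R) (P : probability Z R) (N : nat) (z : 'I_N -> Om -> Z) : Prop :=
  (forall i, measurable_fun setT (z i)) /\
  (forall i A, measurable A -> Pr (z i @^-1` A) = P A) /\
  (forall A : 'I_N -> set Z, (forall i, measurable (A i)) ->
     Pr (\bigcap_(i in [set: 'I_N]) (z i @^-1` A i)) =
     (\prod_(i < N) fine (Pr (z i @^-1` A i)))%:E).

End Defs.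

(* Main.v *)
Require Import Defs.
From HB Require Import structures.
From mathcomp Require Import all_boot all_order all_algebra.
From mathcomp Require Import all_classical all_reals all_analysis.
From mathcomp Require Import measurable_realfun ring lra.
Set Implicit Arguments.
Unset Strict Implicit.
Unset Printing Implicit Defensive.
Import Order.TTheory GRing.Theory Num.Theory.
Import numFieldNormedType.Exports.
Local Open Scope classical_set_scope.
Local Open Scope ring_scope.

(** By Lagrangian duality, the robust risk of [l] at [mu] equals the minimum over
    [0 <= lam <= L / alpha] of [lam * alpha ^+ 2 + mean mu (dual_loss d lam l)],
    where [dual_loss d lam l x = sup_y (l y - lam * d x y ^+ 2)]. Hence the excess
    risk is at most the deviation [P - P_N] of the dual loss of [lhat w] at its
    random optimal multiplier, plus the opposite deviation of one fixed dual loss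
    attached to [lstar]. The latter is controlled by Hoeffding's inequality. The
    former is bounded uniformly over all dual losses by chaining directly with
    Hoeffding tail bounds and a union bound over the links, at scales halving from
    [B / 32]; a cover of the dual losses is the product of a cover of [F] and a
    grid of multipliers, which yields the entropy integral and the [diam] term. *)

(** * Calculus of means of bounded measurable functions *)

Section BoundedMeasurable.
Context {R : realType} {dT : measure_display} {T : measurableType dT}.
Implicit Types (f g : T -> R) (mu : probability T R).

(** Neither [lhat] nor its random multiplier is known to be measurable, nor is a supremum of
    deviations over an infinite class. Each probability estimate therefore concerns finitely many
    fixed functions, and the inequality is then derived for each sample in a measurable event. This
    favours tail bounds over symmetrization, which works with expectations of suprema, and lets the
    chaining stop at a finite level. The Lipschitz constant bounds the multiplier: raising the
    transport budget from 0 to [alpha ^+ 2] raises the mean loss by at most [L * alpha], so a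
    supporting line has slope at most [L / alpha]. The width of this interval of multipliers times
    [diam d ^+ 2] measures how far a dual loss can move, whence the term [L * diam d ^+ 2 / alpha].
    Constants: Hoeffding's scale is 1 / sqrt (2 N), and sqrt (1/2) < 4/5 brings the chaining totals
    48 (entropy) and 60 (multipliers) to at most 48. The failure probability is split in two halves;
    the uniform bound takes [2 * B], the fixed dual loss takes [B]. *)

Definition bounded_mfun f :=
  measurable_fun setT f /\ exists M : R, forall x, `|f x| <= M.

Definition mean mu f : R := \int[mu]_x f x.

Lemma bounded_mfun_integrable mu f : bounded_mfun f ->
  mu.-integrable setT (EFin \o f).
Proof.
move=> [mf [M fM]]; apply: measurable_bounded_integrable => //.
  by rewrite (le_lt_trans (probability_le1 mu _)) ?ltry.
exists M; split; first exact: num_real.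
by move=> y My x _ /=; rewrite (le_trans (fM x)) // ltW.
Qed.

Lemma integral_mean mu f : bounded_mfun f ->
  (\int[mu]_x (f x)%:E = (mean mu f)%:E)%E.
Proof.
move=> bf; rewrite /mean /Rintegral fineK //.
by apply: integrable_fin_num => //; exact: bounded_mfun_integrable.
Qed.

Lemma bounded_mfun_cst (c : R) : bounded_mfun (fun=> c).
Proof. by split => //; exists `|c|. Qed.

Lemma bounded_mfunD f g : bounded_mfun f -> bounded_mfun g ->
  bounded_mfun (fun x => f x + g x).
Proof.
move=> [mf [M fM]] [mg [M' gM]]; split; first exact: measurable_funD.
by exists (M + M') => x; rewrite (le_trans (ler_normD _ _)) ?lerD.
Qed.

Lemma bounded_mfunM f g : bounded_mfun f -> bounded_mfun g ->
  bounded_mfun (fun x => f x * g x).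
Proof.
move=> [mf [M fM]] [mg [M' gM]]; split; first exact: measurable_funM.
by exists (M * M') => x; rewrite normrM ler_pM.
Qed.

Lemma bounded_mfunZ (c : R) f : bounded_mfun f ->
  bounded_mfun (fun x => c * f x).
Proof. by move=> bf; apply: bounded_mfunM => //; exact: bounded_mfun_cst. Qed.

Lemma bounded_mfunN f : bounded_mfun f -> bounded_mfun (fun x => - f x).
Proof.
by move=> bf; under eq_fun do rewrite -mulN1r; exact: bounded_mfunZ.
Qed.

Lemma bounded_mfunB f g : bounded_mfun f -> bounded_mfun g ->
  bounded_mfun (fun x => f x - g x).
Proof. by move=> bf bg; apply: bounded_mfunD => //; exact: bounded_mfunN. Qed.

Lemma bounded_mfun_indic (A : set T) : measurable A ->
  bounded_mfun (\1_A : T -> R).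
Proof.
move=> mA; split; first exact: measurable_indic.
by exists 1 => x; rewrite indicE; case: (x \in A); rewrite ?normr1 ?normr0.
Qed.

Lemma bounded_mfun_range f (a b : R) : measurable_fun setT f ->
  (forall x, a <= f x <= b) -> bounded_mfun f.
Proof.
move=> mf fab; split => //; exists (`|a| + `|b|) => x.
have /andP[ax xb] := fab x.
rewrite ler_norml; apply/andP; split.
  by rewrite (le_trans _ ax) // lerNl (le_trans (ler_norm _)) // normrN lerDl.
by rewrite (le_trans xb) // (le_trans (ler_norm b)) // lerDr.
Qed.

Lemma bounded_mfun_sum (I : Type) (s : seq I) (Q : pred I) (F : I -> T -> R) :
  (forall i, Q i -> bounded_mfun (F i)) ->
  bounded_mfun (fun x => \sum_(i <- s | Q i) F i x).
Proof.
move=> bF; elim: s => [|i s IH].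
  under eq_fun do rewrite big_nil; exact: bounded_mfun_cst.
under eq_fun do rewrite big_cons.
have [Qi|//] := boolP (Q i); by apply: bounded_mfunD => //; exact: bF.
Qed.

Lemma bounded_mfun_prod (I : Type) (s : seq I) (Q : pred I) (F : I -> T -> R) :
  (forall i, Q i -> bounded_mfun (F i)) ->
  bounded_mfun (fun x => \prod_(i <- s | Q i) F i x).
Proof.
move=> bF; elim: s => [|i s IH].
  under eq_fun do rewrite big_nil; exact: bounded_mfun_cst.
under eq_fun do rewrite big_cons.
have [Qi|//] := boolP (Q i); by apply: bounded_mfunM => //; exact: bF.
Qed.

Lemma bounded_mfun_expR f : bounded_mfun f -> bounded_mfun (fun x => expR (f x)).
Proof.
move=> [mf [M fM]]; apply: (@bounded_mfun_range _ 0 (expR M)).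
  by apply: measurableT_comp mf; exact: measurable_expR.
move=> x; rewrite expR_ge0 ler_expR /=.
exact: le_trans (ler_norm _) (fM x).
Qed.

Lemma bounded_mfun_sqr f : bounded_mfun f -> bounded_mfun (fun x => f x ^+ 2).
Proof. by move=> bf; under eq_fun do rewrite expr2; exact: bounded_mfunM. Qed.

Lemma mean_cst mu (c : R) : mean mu (fun=> c) = c.
Proof.
rewrite /mean Rintegral_cst // [X in fine X](_ : _ = 1%E) ?mulr1 //.
exact: probability_setT.
Qed.

Lemma eq_mean mu f g : f =1 g -> mean mu f = mean mu g.
Proof. by move=> /funext ->. Qed.

Lemma meanD mu f g : bounded_mfun f -> bounded_mfun g ->
  mean mu (fun x => f x + g x) = mean mu f + mean mu g.
Proof.
by move=> bf bg; apply: RintegralD => //; exact: bounded_mfun_integrable.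
Qed.

Lemma meanZ mu (c : R) f : bounded_mfun f ->
  mean mu (fun x => c * f x) = c * mean mu f.
Proof.
by move=> bf; apply: RintegralZl => //; exact: bounded_mfun_integrable.
Qed.

Lemma meanN mu f : bounded_mfun f -> mean mu (fun x => - f x) = - mean mu f.
Proof. by move=> bf; under eq_mean do rewrite -mulN1r; rewrite meanZ ?mulN1r. Qed.

Lemma meanB mu f g : bounded_mfun f -> bounded_mfun g ->
  mean mu (fun x => f x - g x) = mean mu f - mean mu g.
Proof. by move=> bf bg; rewrite meanD ?meanN //; exact: bounded_mfunN. Qed.

Lemma le_mean mu f g : bounded_mfun f -> bounded_mfun g ->
  (forall x, f x <= g x) -> mean mu f <= mean mu g.
Proof.
by move=> bf bg fg; apply: le_Rintegral => //; exact: bounded_mfun_integrable.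
Qed.

Lemma mean_le_cst mu f (c : R) : bounded_mfun f -> (forall x, f x <= c) ->
  mean mu f <= c.
Proof.
by move=> bf fc; rewrite -(mean_cst mu c) le_mean //; exact: bounded_mfun_cst.
Qed.

Lemma mean_ge_cst mu f (c : R) : bounded_mfun f -> (forall x, c <= f x) ->
  c <= mean mu f.
Proof.
by move=> bf fc; rewrite -(mean_cst mu c) le_mean //; exact: bounded_mfun_cst.
Qed.

Lemma mean_sum mu (I : Type) (s : seq I) (F : I -> T -> R) :
  (forall i, bounded_mfun (F i)) ->
  mean mu (fun x => \sum_(i <- s) F i x) = \sum_(i <- s) mean mu (F i).
Proof.
move=> bF; elim: s => [|i s IH].
  by under eq_mean do rewrite big_nil; rewrite mean_cst big_nil.
under eq_mean do rewrite big_cons.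
by rewrite meanD ?big_cons ?IH //; exact: bounded_mfun_sum.
Qed.

Lemma mean_indic mu (A : set T) : measurable A -> mean mu \1_A = fine (mu A).
Proof. by move=> mA; rewrite /mean /Rintegral integral_indic // setIT. Qed.

End BoundedMeasurable.

Lemma bounded_mfun_comp {R : realType} {d1 d2 : measure_display}
    {T1 : measurableType d1} {T2 : measurableType d2} (f : T2 -> R) (h : T1 -> T2) :
  measurable_fun setT h -> bounded_mfun f -> bounded_mfun (fun x => f (h x)).
Proof.
move=> mh [mf [M fM]]; split; first exact: measurableT_comp.
by exists M => x.
Qed.

(** Yields both the marginals of a coupling and the coupling carried by the graph of a map; later
    arguments see only its values and means. *)
Lemma probability_pushforward {R : realType} {d1 d2 : measure_display}
    {T1 : measurableType d1} {T2 : measurableType d2}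
    (mu : probability T1 R) (h : T1 -> T2) : measurable_fun setT h ->
  exists nu : probability T2 R,
    (forall A, nu A = mu (h @^-1` A)) /\
    forall f, bounded_mfun f -> mean nu f = mean mu (fun x => f (h x)).
Proof.
move=> mh.
pose X : {mfun T1 >-> T2} := HB.pack h (isMeasurableFun.Build _ _ _ _ _ mh).
exists (distribution mu X); split => // f bf.
rewrite /mean /Rintegral integral_distribution //.
  by apply/measurable_EFinP; case: bf.
exact: (bounded_mfun_integrable mu (bounded_mfun_comp mh bf)).
Qed.

(** * Mixtures of two probability measures *)

Section Mixture.
Context {R : realType} {dT : measure_display} {T : measurableType dT}.
Variables (t : R) (ht : 0 <= t <= 1) (mu nu : probability T R).

Let wl_ge0 : 0 <= t. Proof. by case/andP : ht. Qed.
Let wl : {nonneg R} := NngNum wl_ge0.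
Let wr_ge0 : 0 <= 1 - t. Proof. by rewrite subr_ge0; case/andP : ht. Qed.
Let wr : {nonneg R} := NngNum wr_ge0.

Definition mixture_measure : set T -> \bar R :=
  measure_add (mscale wl mu) (mscale wr nu).

HB.instance Definition _ := Measure.on mixture_measure.

Let mixture_setT : mixture_measure setT = 1%E.
Proof.
transitivity (t%:E * mu setT + (1 - t)%:E * nu setT)%E.
  by rewrite /mixture_measure measure_addE.
rewrite !probability_setT !mule1.
by rewrite -EFinD addrC subrK.
Qed.

HB.instance Definition _ :=
  Measure_isProbability.Build _ _ _ mixture_measure mixture_setT.

(** Serves twice: couplings with a fixed first marginal are stable under mixtures, and an empirical
    measure arises from Dirac masses by successive mixtures. *)
Lemma probability_mixture : exists m : probability T R,
  (forall A, m A = (t%:E * mu A + (1 - t)%:E * nu A)%E) /\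
  forall f, bounded_mfun f -> mean m f = t * mean mu f + (1 - t) * mean nu f.
Proof.
exists mixture_measure; split.
  by move=> A; rewrite /= /mixture_measure measure_addE.
have ge0E (f : T -> R) : bounded_mfun f -> (forall x, 0 <= f x) ->
    mean mixture_measure f = t * mean mu f + (1 - t) * mean nu f.
  move=> bf f0; apply/EFin_inj.
  have mf : measurable_fun setT (EFin \o f) by apply/measurable_EFinP; case: bf.
  rewrite EFinD !EFinM -!integral_mean //.
  rewrite ge0_integral_measure_add //; last by move=> x _; rewrite lee_fin.
  by rewrite !ge0_integral_mscale // => x _; rewrite lee_fin.
(* The non-negative case applies to [f + M]; the weights sum to 1, so the added constant cancels. *)
move=> f bf; have [_ [M fM]] := bf.
have bM := @bounded_mfun_cst R _ T M.
have fM0 x : 0 <= f x + M.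
  by rewrite -lerBlDr sub0r; have := fM x; rewrite ler_norml => /andP[].
have := ge0E _ (bounded_mfunD bf bM) fM0.
rewrite !meanD // !mean_cst; lra.
Qed.

End Mixture.

(** * Independence: from events to products of bounded functions *)

Section IndependentProducts.
Context {R : realType}.

(** The sum is the minimum of [n] and the floor of [y]: the height of a staircase with [n] unit
    steps below [y]. *)
Lemma sum_le_nat_floor (n : nat) (y : R) : 0 <= y ->
  let s := \sum_(j < n) ((j.+1)%:R <= y)%R%:R in
  s <= y /\ (y <= n%:R -> y - 1 <= s) /\ (n%:R <= y -> s = n%:R).
Proof.
move=> y0 s; rewrite {}/s; elim: n => [|n [IH1 [IH2 IH3]]].
  by rewrite big_ord0; split => //; split => //; lra.
rewrite big_ord_recr /=; have n1 : n.+1%:R = n%:R + 1 :> R by rewrite natr1.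
have [yn|yn] := leP (n.+1%:R) y.
  have -> : \sum_(i < n) (i.+1%:R <= y)%R%:R = n%:R :> R by apply: IH3; lra.
  by rewrite /=; split; [lra|split; lra].
rewrite addr0; split => //; split; last lra.
by move=> _; have [/IH2//|/ltW/IH3 ->] := leP y n%:R; lra.
Qed.

(** Layer cake: counting the levels [j.+1 * e - M] that lie below [g x] recovers [g x + M] up to one
    step of height [e]. *)
Lemma bounded_mfun_approx {dT : measure_display} {T : measurableType dT}
    (g : T -> R) (e : R) : bounded_mfun g -> 0 < e ->
  exists (n : nat) (c : R) (A : nat -> set T),
    (forall j, measurable (A j)) /\
    forall x, `|g x - (c + \sum_(j < n) e * \1_(A j) x)| <= e.
Proof.
move=> [mg [M gM]] e0; exists (Num.truncn (2 * M / e)).+1, (- M).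
exists (fun j => [set x | j.+1%:R * e - M <= g x]); split.
  move=> j; rewrite -[X in measurable X]setTI.
  by have := mg measurableT _ (measurable_itv `[j.+1%:R * e - M, +oo[);
     rewrite set_itvcy.
move=> x; set y := (g x + M) / e.
have gx := gM x; rewrite ler_norml in gx; case/andP: gx => gx1 gx2.
have y0 : 0 <= y by rewrite divr_ge0 ?(ltW e0) //; lra.
have yn : y <= (Num.truncn (2 * M / e)).+1%:R.
  apply: (@le_trans _ _ (2 * M / e)); last by rewrite ltW // truncnS_gt.
  by rewrite ler_pM2r ?invr_gt0 //; lra.
have [h1 [/(_ yn) h2 _]] := sum_le_nat_floor (Num.truncn (2 * M / e)).+1 y0.
rewrite -mulr_sumr (_ : \sum_(j < _) _ =
    \sum_(j < (Num.truncn (2 * M / e)).+1) ((j.+1)%:R <= y)%R%:R); last first.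
  apply: eq_bigr => j _; rewrite indicE /y; congr (_%:R); congr nat_of_bool.
  by apply/idP/idP; rewrite ler_pdivlMr // inE /=; lra.
set s := \sum_(_ < _) _ in h1 h2 *.
have -> : g x - (- M + e * s) = e * (y - s).
  by rewrite /y mulrBr mulrCA divff ?gt_eqF // mulr1; ring.
rewrite normrM gtr0_norm // ger_pMr // ler_norml; lra.
Qed.

(* Factorization against indicators extends to bounded functions by uniform
   approximation with simple functions. *)
Lemma mean_factor_of_indic {d1 d2 : measure_display} {T1 : measurableType d1}
    {T2 : measurableType d2} (Q : probability T1 R) (P : probability T2 R)
    (X : T1 -> T2) (h : T1 -> R) (g : T2 -> R) :
  measurable_fun setT X -> bounded_mfun h -> bounded_mfun g ->
  (forall A, measurable A ->
     mean Q (fun w => \1_A (X w) * h w) = fine (P A) * mean Q h) ->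
  mean Q (fun w => g (X w) * h w) = mean P g * mean Q h.
Proof.
move=> mX bh bg indA; have [_ [H hH]] := bh.
have H0 : 0 <= H by exact: le_trans (normr_ge0 _) (hH point).
apply/eqP; rewrite -subr_eq0 -normr_le0; apply/ler_addgt0Pl => e e0.
(* Approximating [g] within [e'] costs [e' * H] on each side of the identity; the extra [1] keeps
   the denominator positive when [H = 0]. *)
rewrite addr0; set e' := e / (2 * H + 1).
have e'0 : 0 < e' by rewrite divr_gt0 //; lra.
have [n [c [A [mA gA]]]] := bounded_mfun_approx bg e'0.
pose s x := c + \sum_(j < n) e' * \1_(A j) x.
have b1 j : bounded_mfun (fun x => e' * (\1_(A j) x : R)).
  by apply: bounded_mfunZ; exact: bounded_mfun_indic.
have bs : bounded_mfun s.
  apply: bounded_mfunD; first exact: bounded_mfun_cst.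
  exact: (@bounded_mfun_sum _ _ _ _ _ _ (fun (j : 'I_n) x => e' * \1_(A j) x)).
have b1X j : bounded_mfun (fun w => \1_(A j) (X w) * h w).
  apply: bounded_mfunM => //; apply: (@bounded_mfun_comp _ _ _ _ _ (\1_(A j))) => //.
  exact: bounded_mfun_indic.
have sE : mean Q (fun w => s (X w) * h w) = mean P s * mean Q h.
  transitivity (mean Q (fun w => c * h w +
      \sum_(j < n) e' * (\1_(A j) (X w) * h w))).
    apply: eq_mean => w; rewrite /s mulrDl mulr_suml; congr (_ + _).
    by apply: eq_bigr => j _; rewrite mulrA.
  rewrite meanD ?meanZ //; [|exact: bounded_mfunZ|]; last first.
    apply: (@bounded_mfun_sum _ _ _ _ _ _ (fun (j : 'I_n) w =>
      e' * (\1_(A j) (X w) * h w))) => j _; exact: bounded_mfunZ.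
  rewrite (@mean_sum _ _ _ _ _ _ (fun (j : 'I_n) w =>
      e' * (\1_(A j) (X w) * h w))); last by move=> j; exact: bounded_mfunZ.
  rewrite /s meanD; [|exact: bounded_mfun_cst|
    exact: (@bounded_mfun_sum _ _ _ _ _ _ (fun (j : 'I_n) x => e' * \1_(A j) x))].
  rewrite (@mean_sum _ _ _ _ _ _ (fun (j : 'I_n) x => e' * \1_(A j) x)) //.
  rewrite mean_cst mulrDl mulr_suml; congr (_ + _); apply: eq_bigr => j _.
  rewrite !meanZ // ?indA // ?mean_indic ?mulrA //; exact: bounded_mfun_indic.
have bgX : bounded_mfun (fun w => g (X w) * h w).
  by apply: bounded_mfunM => //; exact: bounded_mfun_comp.
have bsX : bounded_mfun (fun w => s (X w) * h w).
  by apply: bounded_mfunM => //; exact: bounded_mfun_comp.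
have -> : mean Q (fun w => g (X w) * h w) - mean P g * mean Q h =
    mean Q (fun w => g (X w) * h w - s (X w) * h w)
    - mean P (fun x => g x - s x) * mean Q h.
  by rewrite !meanB // sE; ring.
have mle d (T : measurableType d) (mu : probability T R) (f : T -> R) (C : R) :
    bounded_mfun f -> (forall x, `|f x| <= C) -> `|mean mu f| <= C.
  move=> bf fC; rewrite ler_norml mean_ge_cst ?mean_le_cst // => x;
    by have := fC x; rewrite ler_norml => /andP[].
have -> : e = e' * H + e' * H + e' by rewrite /e'; field; rewrite gt_eqF //; lra.
apply: (@le_trans _ _ (e' * H + e' * H)); last by rewrite lerDl ltW.
rewrite (le_trans (ler_normB _ _)) // lerD //.
  apply: mle; first exact: bounded_mfunB.
  by move=> w; rewrite -mulrBl normrM ler_pM.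
rewrite normrM ler_pM //; last exact: mle.
by apply: mle => //; exact: bounded_mfunB.
Qed.

Context {dO : measure_display} {Om : measurableType dO}.
Context {dZ : measure_display} {Z : measurableType dZ}.

Lemma iid_mean_prod (Q : probability Om R) (P : probability Z R) (N : nat)
    (z : 'I_N -> Om -> Z) (g : 'I_N -> Z -> R) :
  iid_sample Q P z -> (forall i, bounded_mfun (g i)) ->
  mean Q (fun w => \prod_(i < N) g i (z i w)) = \prod_(i < N) mean P (g i).
Proof.
move=> [mz [Pz indep]] bg.
(* Independence is given for indicator factors. Induction on [k] frees the factors one at a time:
   those of index at least [k] are still indicators, and [k = N] imposes nothing. *)
suff H k : forall g : 'I_N -> Z -> R, (forall i, bounded_mfun (g i)) ->
    (forall i : 'I_N, (k <= i)%N -> exists2 A, measurable A & g i = \1_A) ->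
    mean Q (fun w => \prod_(i < N) g i (z i w)) = \prod_(i < N) mean P (g i).
  by apply: (H N) => // i; rewrite leqNgt ltn_ord.
elim: k => [|k IH] {}g {}bg gA.
  have /choice[A AP] i : exists A, measurable A /\ g i = \1_A.
    by have [A mA gE] := gA i (leq0n i); exists A.
  have mA i : measurable (A i) by have [] := AP i.
  have mzA i : measurable (z i @^-1` A i).
    by rewrite -[X in measurable X]setTI; exact: mz.
  transitivity (mean Q (\1_(\bigcap_(i in [set: 'I_N]) (z i @^-1` A i)))).
    apply: eq_mean => w; rewrite indicE.
    have [wA|] := pselect ((\bigcap_(i in [set: 'I_N]) (z i @^-1` A i)) w).
      rewrite mem_set // big1 // => i _; have [_ ->] := AP i.
      by rewrite indicE mem_set //; exact: wA.
    move=> nwA; rewrite memNset //.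
    have /existsNP[i /not_implyP[_ nA]] := nwA.
    rewrite (bigD1 i) //=; have [_ ->] := AP i.
    by rewrite indicE memNset // mul0r.
  rewrite mean_indic; last by apply: fin_bigcap_measurable.
  rewrite indep //=; apply: eq_bigr => i _; have [_ ->] := AP i.
  by rewrite mean_indic // Pz.
have [Nk|kN] := leqP N k.
  by apply: IH => // i ki; have := ltn_ord i; rewrite ltnNge (leq_trans Nk ki).
pose i0 := Ordinal kN.
pose h w := \prod_(i < N | i != i0) g i (z i w).
have bh : bounded_mfun h.
  apply: (@bounded_mfun_prod _ _ _ _ _ _ (fun i w => g i (z i w))) => i _.
  exact: bounded_mfun_comp.
(* With factor [i0] replaced by an indicator, the induction hypothesis applies; this is the case
   that [mean_factor_of_indic] extends to [g i0]. *)
have key A : measurable A -> mean Q (fun w => \1_A (z i0 w) * h w) =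
    fine (P A) * \prod_(i < N | i != i0) mean P (g i).
  move=> mA; pose g' i := if i == i0 then \1_A else g i.
  have g'0 : g' i0 = \1_A by rewrite /g' eqxx.
  have := IH g' _ _; rewrite [X in _ = X](bigD1 i0) //= g'0 mean_indic //.
  rewrite (eq_bigr (fun i => mean P (g i))); last first.
    by move=> i /negbTE ni; rewrite /g' ni.
  move=> <-.
  - apply: eq_mean => w; rewrite (bigD1 i0) //= /g' eqxx; congr (_ * _).
    by apply: eq_bigr => i /negbTE ->.
  - by move=> i; rewrite /g'; case: ifP => // _; exact: bounded_mfun_indic.
  - move=> i ki; rewrite /g'; case: ifPn => [_|ni]; first by exists A.
    apply: gA; rewrite ltn_neqAle ki andbT; apply: contra ni => /eqP kE.
    by apply/eqP/val_inj.
have hE : mean Q h = \prod_(i < N | i != i0) mean P (g i).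
  have := key _ measurableT; rewrite probability_setT mul1r => <-.
  by apply: eq_mean => w; rewrite indicT mul1r.
rewrite (bigD1 i0) //= -hE -(mean_factor_of_indic (mz i0) bh (bg i0)).
  by apply: eq_mean => w; rewrite (bigD1 i0).
by move=> A mA; rewrite key // hE.
Qed.

End IndependentProducts.

(** * Hoeffding's lemma and inequality *)

Section Hoeffding.
Context {R : realType}.

Lemma le_of_is_derive_ge0 (f df : R -> R) (t : R) :
  (forall x : R, is_derive x 1 f (df x)) -> (forall x, 0 <= x -> 0 <= df x) ->
  0 <= t -> f 0 <= f t.
Proof.
move=> fdf df0; rewrite le_eqVlt => /predU1P[<- //|t0].
have [|c] := @MVT R f df 0 t t0 (fun x _ => fdf x).
  apply/continuous_subspaceT => x; apply/differentiable_continuous.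
  by apply/derivable1_diffP; exact: ex_derive.
rewrite in_itv /= => /andP[c0 _]; rewrite subr0 => E.
by rewrite -subr_ge0 E mulr_ge0 ?df0 ?ltW.
Qed.

(** Two integrations: [ln (w x)] has derivative [theta = p * expR x / w x], whose own derivative
    [theta * (1 - theta)] is at most [1/4], the gap being the square [(theta - 1/2) ^+ 2]. *)
Lemma bernoulli_mgf_le (p t : R) : 0 <= p <= 1 -> 0 <= t ->
  1 - p + p * expR t <= expR (t * p + t ^+ 2 / 8).
Proof.
move=> /andP[p0 p1] t0; pose w (x : R) : R := 1 - p + p * expR x.
have w0 (x : R) : 0 < w x.
  rewrite /w; have [->|pn0] := eqVneq p 0; first by lra.
  by rewrite ltr_wpDl ?subr_ge0 // mulr_gt0 ?expR_gt0 // lt_neqAle eq_sym pn0.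
have dw (x : R) : is_derive x 1 w (p * expR x).
  rewrite /w; apply: is_derive_eq; rewrite /GRing.scale /=. ring.
have ratio (x : R) : 0 <= x -> p * expR x / w x <= p + x / 4.
  pose f (y : R) : R := p + y / 4 - p * expR y / w y.
  have df (y : R) : is_derive y 1 f ((p * expR y / w y - 2^-1) ^+ 2).
    have dV : is_derive y 1 (fun u => (w u)^-1) (- (w y) ^- 2 * (p * expR y)).
      by apply: is_deriveV; rewrite gt_eqF.
    rewrite /f; apply: is_derive_eq; rewrite /GRing.scale /=; field; rewrite gt_eqF //.
  move=> x0; have := le_of_is_derive_ge0 df (fun y _ => sqr_ge0 _) x0.
  have -> : f 0 = 0 by rewrite /f /w expR0 mulr1 subrK divr1; lra.
  by rewrite /f subr_ge0.
pose g (x : R) : R := x * p + x ^+ 2 / 8 - ln (w x).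
have dg (x : R) : is_derive x 1 g (p + x / 4 - p * expR x / w x).
  have dl : is_derive x 1 (fun u => ln (w u)) ((w x)^-1 * (p * expR x)).
    by apply: (@is_derive1_comp _ (@ln R) w); exact: is_derive1_ln.
  rewrite /g; apply: is_derive_eq; rewrite /GRing.scale /=; field; rewrite gt_eqF //.
have dg0 (x : R) : 0 <= x -> 0 <= p + x / 4 - p * expR x / w x.
  by move=> x0; rewrite subr_ge0 ratio.
have := le_of_is_derive_ge0 dg dg0 t0.
have -> : g 0 = 0 by rewrite /g /w expR0 mulr1 subrK ln1; lra.
by rewrite /g subr_ge0 -ler_expR lnK // posrE; exact: w0.
Qed.

Lemma expR_convex_le (t x : R) : 0 <= x <= 1 ->
  expR (t * x) <= 1 - x + x * expR t.
Proof.
move=> /andP[x0 x1]; have := convex_expR (Itv01 x0 x1) t 0.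
by rewrite !convRE /= expR0 mulr0 addr0 mulr1 addrC [t * x]mulrC.
Qed.

Context {dO : measure_display} {Om : measurableType dO}.
Context {dZ : measure_display} {Z : measurableType dZ}.

(** By convexity of the exponential, [f] is dominated by the Bernoulli variable with the same
    mean. *)
Lemma hoeffding_mgf (P : probability Z R) (f : Z -> R) (t : R) :
  measurable_fun setT f -> (forall x, 0 <= f x <= 1) -> 0 <= t ->
  mean P (fun x => expR (t * (f x - mean P f))) <= expR (t ^+ 2 / 8).
Proof.
move=> mf f01 t0; have bf := bounded_mfun_range mf f01.
set p := mean P f.
have p01 : 0 <= p <= 1.
  by apply/andP; split; [apply: mean_ge_cst|apply: mean_le_cst] => // x;
     case/andP: (f01 x).
have -> : mean P (fun x => expR (t * (f x - p))) =
    expR (- (t * p)) * mean P (fun x => expR (t * f x)).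
  rewrite -meanZ; last by apply: bounded_mfun_expR; exact: bounded_mfunZ.
  by apply: eq_mean => x; rewrite -expRD; congr expR; ring.
have b1 := bounded_mfun_cst 1.
have le1 : mean P (fun x => expR (t * f x)) <= 1 - p + p * expR t.
  have -> : 1 - p + p * expR t = mean P (fun x => (1 - f x) + expR t * f x).
    rewrite meanD ?meanB ?meanZ ?mean_cst //; last 2 first.
    - exact: bounded_mfunB.
    - exact: bounded_mfunZ.
    by rewrite mulrC.
  apply: le_mean.
  - by apply: bounded_mfun_expR; exact: bounded_mfunZ.
  - by apply: bounded_mfunD; [exact: bounded_mfunB|exact: bounded_mfunZ].
  - by move=> x; rewrite [expR t * _]mulrC; exact: expR_convex_le.
have -> : expR (t ^+ 2 / 8) = expR (- (t * p)) * expR (t * p + t ^+ 2 / 8).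
  by rewrite -expRD; congr expR; ring.
by rewrite ler_pM2l ?expR_gt0 // (le_trans le1) // bernoulli_mgf_le.
Qed.

Definition sample_mean (N : nat) (z : 'I_N -> Om -> Z) (w : Om) (f : Z -> R) : R :=
  N%:R^-1 * \sum_(i < N) f (z i w).

Lemma bounded_mfun_sample_mean (N : nat) (z : 'I_N -> Om -> Z) (f : Z -> R) :
  (forall i, measurable_fun setT (z i)) -> bounded_mfun f ->
  bounded_mfun (fun w => sample_mean z w f).
Proof.
move=> mz bf; apply: bounded_mfunZ.
apply: (@bounded_mfun_sum _ _ _ _ _ _ (fun i w => f (z i w))) => i _.
exact: bounded_mfun_comp.
Qed.

Lemma chernoff_mean (Q : probability Om R) (Y : Om -> R) (c : R) :
  bounded_mfun Y ->
  (Q [set w | (c <= Y w)%R] <= (mean Q (fun w => expR (Y w - c)))%:E)%E.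
Proof.
move=> bY; have mA : measurable [set w | c <= Y w].
  rewrite -[X in measurable X]setTI.
  by have := bY.1 measurableT _ (measurable_itv `[c, +oo[); rewrite set_itvcy.
rewrite -[leLHS]fineK ?fin_num_measure // -mean_indic // lee_fin.
apply: le_mean; first exact: bounded_mfun_indic.
  by apply/bounded_mfun_expR/bounded_mfunB => //; exact: bounded_mfun_cst.
move=> w; rewrite indicE; case: (boolP (w \in _)) => [|_]; last exact: expR_ge0.
by rewrite inE /= => cY; rewrite -expR0 ler_expR subr_ge0.
Qed.

(** Measuring deviations in units of [a / sqrt (2 * N)] gives the plain tail [expR (- q ^+ 2)], so
    that a union bound over [n] functions is absorbed by adding [sqrt (ln n)] to [q]. *)
Lemma hoeffding (Q : probability Om R) (P : probability Z R) (N : nat)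
    (z : 'I_N -> Om -> Z) (f : Z -> R) (a q : R) :
  (0 < N)%N -> iid_sample Q P z -> bounded_mfun f -> 0 <= a ->
  (exists c, forall x, c <= f x <= c + a) -> 0 <= q ->
  (Q [set w | (a * q * Num.sqrt (2 * N%:R)^-1 < sample_mean z w f - mean P f)%R]
     <= (expR (- q ^+ 2))%:E)%E.
Proof.
move=> N0 iid bf a0 [c fc] q0; have [mz [Pz indep]] := iid.
have N0' : (0 : R) < N%:R by rewrite ltr0n.
set s := Num.sqrt (2 * N%:R)^-1.
have s2 : s ^+ 2 = (2 * N%:R)^-1 by rewrite sqr_sqrtr // invr_ge0; lra.
have s0 : 0 <= s by exact: sqrtr_ge0.
(* A constant [f] has no deviation, and the strict inequality makes the event empty. *)
have [aE|an0] := eqVneq a 0.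
  rewrite aE !mul0r (_ : [set _ | _] = set0) ?measure0 ?lee_fin ?expR_ge0 //.
  rewrite -subset0 => w /=; have {}fc x : f x = c.
    by apply/le_anti; rewrite andbC; have := fc x; rewrite aE addr0.
  rewrite /sample_mean (eq_bigr (fun=> c)) => [|i _]; last exact: fc.
  rewrite (eq_mean _ fc) mean_cst sumr_const card_ord -[c *+ N]mulr_natl.
  by rewrite mulrA mulVf ?gt_eqF // mul1r subrr ltxx.
have {an0}a0 : 0 < a by rewrite lt_neqAle eq_sym an0.
pose g x := (f x - c) / a.
have g01 x : 0 <= g x <= 1.
  have /andP[h1 h2] := fc x.
  by rewrite /g ler_pdivlMr // ler_pdivrMr // mul0r mul1r; lra.
have mg : measurable_fun setT g.
  apply: measurable_funM => //; apply: measurable_funB => //; exact: bf.1.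
have bg := bounded_mfun_range mg g01.
(* Minimizes the Chernoff exponent [- (l * N * q * s) + N * l ^+ 2 / 8]; the minimum is
   [- q ^+ 2]. *)
pose l := 4 * q * s; have l0 : 0 <= l by rewrite /l !mulr_ge0.
pose G (i : 'I_N) x := l * (g x - mean P g).
have bG i : bounded_mfun (G i).
  by apply/bounded_mfunZ/bounded_mfunB => //; exact: bounded_mfun_cst.
pose Y w := \sum_(i < N) G i (z i w).
have bY : bounded_mfun Y.
  apply: (@bounded_mfun_sum _ _ _ _ _ _ (fun i w => G i (z i w))) => i _.
  exact: bounded_mfun_comp.
have fE : mean P f = c + a * mean P g.
  rewrite -(mean_cst P c) -meanZ // -meanD; [|exact: bounded_mfun_cst|exact: bounded_mfunZ].
  by apply: eq_mean => x; rewrite /g mulrCA divff ?gt_eqF // mulr1; ring.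
have YE w : Y w = l * N%:R / a * (sample_mean z w f - mean P f).
  rewrite /Y /G -mulr_sumr sumrB sumr_const card_ord /sample_mean fE /g.
  rewrite -mulr_suml sumrB sumr_const card_ord -[c *+ _]mulr_natr -[_ *+ N]mulr_natr.
  by field; rewrite !gt_eqF.
have mD : measurable [set w | a * q * s < sample_mean z w f - mean P f].
  have bD := bounded_mfunB (bounded_mfun_sample_mean mz bf)
    (bounded_mfun_cst (mean P f)).
  have := bD.1 measurableT _ (measurable_itv `]a * q * s, +oo[).
  by rewrite set_itvoy setTI.
have mY : measurable [set w | l * N%:R * q * s <= Y w].
  by have := bY.1 measurableT _ (measurable_itv `[l * N%:R * q * s, +oo[);
     rewrite set_itvcy setTI.
apply: (@le_trans _ _ (Q [set w | l * N%:R * q * s <= Y w])).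
  apply: le_measure; rewrite ?inE // => w /= h; rewrite YE.
  have -> : l * N%:R * q * s = l * N%:R / a * (a * q * s).
    by field; rewrite gt_eqF.
  apply: ler_wpM2l; last exact: ltW.
  by rewrite divr_ge0 ?mulr_ge0 ?(ltW a0).
apply: (le_trans (chernoff_mean _ _ bY)); rewrite lee_fin.
have -> : mean Q (fun w => expR (Y w - l * N%:R * q * s)) =
    expR (- (l * N%:R * q * s)) * mean Q (fun w => \prod_(i < N) expR (G i (z i w))).
  rewrite -meanZ.
    by apply: eq_mean => w; rewrite -expR_sum -expRD addrC.
  apply: (@bounded_mfun_prod _ _ _ _ _ _ (fun i w => expR (G i (z i w)))) => i _.
  exact/bounded_mfun_expR/bounded_mfun_comp.
rewrite (iid_mean_prod (g := fun i x => expR (G i x)) iid); last first.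
  by move=> i; exact: bounded_mfun_expR.
have -> : - q ^+ 2 = - (l * N%:R * q * s) + N%:R * (l ^+ 2 / 8).
  have -> : l ^+ 2 = 16 * q ^+ 2 * s ^+ 2 by rewrite /l; ring.
  have -> : l * N%:R * q * s = 4 * N%:R * q ^+ 2 * s ^+ 2 by rewrite /l; ring.
  by rewrite s2; field; rewrite gt_eqF.
rewrite expRD ler_pM2l ?expR_gt0 //.
rewrite (_ : N%:R * (l ^+ 2 / 8) = \sum_(i < N) (l ^+ 2 / 8)); last first.
  by rewrite sumr_const card_ord mulr_natl.
rewrite expR_sum; apply: ler_prod => i _; rewrite hoeffding_mgf // andbT.
by apply: mean_ge_cst => [|x]; [exact: bounded_mfun_expR|exact: expR_ge0].
Qed.

End Hoeffding.

(** * Union bounds and chaining along finite covers *)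

Section Chaining.
Context {R : realType}.
Context {dO : measure_display} {Om : measurableType dO}.
Context {dZ : measure_display} {Z : measurableType dZ}.
Variables (Q : probability Om R) (P : probability Z R).
Variables (N : nat) (z : 'I_N -> Om -> Z).
Hypothesis N0 : (0 < N)%N.
Hypothesis iid : iid_sample Q P z.

Lemma probability_mean (A : set Om) : measurable A -> Q A = (mean Q \1_A)%:E.
Proof. by move=> mA; rewrite mean_indic // fineK // fin_num_measure. Qed.

Lemma probability_union_le (n : nat) (A : 'I_n -> set Om) (r : 'I_n -> R) :
  (forall i, measurable (A i)) -> (forall i, (Q (A i) <= (r i)%:E)%E) ->
  (Q (\bigcup_(i in [set: 'I_n]) A i) <= (\sum_(i < n) r i)%:E)%E.
Proof.
move=> mA Ar.
have mU : measurable (\bigcup_(i in [set: 'I_n]) A i).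
  exact: fin_bigcup_measurable.
rewrite probability_mean // lee_fin.
apply: (@le_trans _ _ (mean Q (fun w => \sum_(i < n) \1_(A i) w))).
  apply: le_mean; first exact: bounded_mfun_indic.
    apply: (@bounded_mfun_sum _ _ _ _ _ _ (fun i => \1_(A i))) => i _.
    exact: bounded_mfun_indic.
  move=> w; rewrite indicE; case: (boolP (w \in _)) => [|_]; last first.
    by apply: sumr_ge0 => i _; rewrite indicE.
  rewrite inE => -[i _ Aiw]; rewrite (bigD1 i) //= indicE mem_set // lerDl.
  by apply: sumr_ge0 => j _; rewrite indicE.
rewrite (@mean_sum _ _ _ _ _ _ (fun i => \1_(A i))); last first.
  by move=> i; exact: bounded_mfun_indic.
by apply: ler_sum => i _; rewrite -lee_fin -probability_mean.
Qed.

Definition deviation (w : Om) (f : Z -> R) := mean P f - sample_mean z w f.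

Lemma bounded_mfun_deviation f : bounded_mfun f ->
  bounded_mfun (fun w => deviation w f).
Proof.
move=> bf; apply: bounded_mfunB; first exact: bounded_mfun_cst.
by apply: bounded_mfun_sample_mean => //; case: iid.
Qed.

Lemma deviationB w f g : bounded_mfun f -> bounded_mfun g ->
  deviation w (fun x => f x - g x) = deviation w f - deviation w g.
Proof.
by move=> bf bg; rewrite /deviation meanB // /sample_mean sumrB mulrBr; ring.
Qed.

Lemma deviationN w f : bounded_mfun f ->
  deviation w (fun x => - f x) = - deviation w f.
Proof.
by move=> bf; rewrite /deviation meanN // /sample_mean sumrN mulrN; ring.
Qed.

Lemma deviation_le w f (e : R) : bounded_mfun f -> (forall x, `|f x| <= e) ->
  deviation w f <= 2 * e.
Proof.
move=> bf fe; have fb x : - e <= f x <= e by rewrite -ler_norml.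
have h1 : mean P f <= e.
  by apply: mean_le_cst => // x; case/andP: (fb x).
have h2 : - e <= sample_mean z w f.
  rewrite /sample_mean ler_pdivlMl ?ltr0n //.
  have -> : N%:R * - e = \sum_(i < N) - e by rewrite sumr_const card_ord mulr_natl.
  by apply: ler_sum => i _; case/andP: (fb (z i w)).
by rewrite /deviation; lra.
Qed.

Let s := Num.sqrt (2 * N%:R)^-1 : R.

Lemma deviation_family (n : nat) (f : 'I_n -> Z -> R) (a q : R) :
  0 <= a -> 0 <= q -> (forall i, bounded_mfun (f i)) ->
  (forall i, exists c, forall x, c <= f i x <= c + a) ->
  exists E : set Om, [/\ measurable E, (Q (~` E) <= (n%:R * expR (- q ^+ 2))%:E)%E &
    forall w, E w -> forall i, deviation w (f i) <= a * q * s].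
Proof.
move=> a0 q0 bf fa.
pose A i := [set w | a * q * s < deviation w (f i)].
have mA i : measurable (A i).
  have := (bounded_mfun_deviation (bf i)).1 measurableT _
    (measurable_itv `]a * q * s, +oo[).
  by rewrite set_itvoy setTI.
exists (~` (\bigcup_(i in [set: 'I_n]) A i)); split.
- by apply: measurableC; exact: fin_bigcup_measurable.
- rewrite setCK.
  have -> : n%:R * expR (- q ^+ 2) = \sum_(i < n) expR (- q ^+ 2) :> R.
    by rewrite sumr_const card_ord mulr_natl.
  apply: probability_union_le => // i.
  have -> : A i = [set w | a * q * s <
      sample_mean z w (fun x => - f i x) - mean P (fun x => - f i x)].
    apply/funext => w; rewrite /A /= /deviation meanN // /sample_mean sumrN.
    by rewrite mulrN opprK addrC.
  apply: hoeffding => //; first exact: bounded_mfunN.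
  have [c ca] := fa i; exists (- (c + a)) => x; have /andP[h1 h2] := ca x; lra.
- move=> w nA i; rewrite leNgt; apply/negP => h; apply: nA.
  by exists i.
Qed.

(** Each center of level [k + 1] is linked to one center of level [k], so there are only [m k.+1]
    links, each with range of length [2 * delta k]; hence the pairing of [delta k] with [q k.+1]. *)
Lemma chaining (G : set (Z -> R)) (B : R) (delta q p : nat -> R) (m : nat -> nat)
    (K : nat) : 0 <= B ->
  (forall f, G f -> measurable_fun setT f /\ forall x, 0 <= f x <= B) ->
  (forall k, has_cover G (delta k) (m k)) ->
  (forall k, 0 <= delta k) -> (forall k, 0 <= q k) ->
  (forall k, (m k)%:R * expR (- q k ^+ 2) <= p k) ->
  exists E : set Om, [/\ measurable E,
    (Q (~` E) <= (\sum_(k < K.+1) p k)%:E)%E &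
    forall w, E w -> forall f, G f -> deviation w f <=
      B * q 0%N * s + \sum_(k < K) 2 * delta k * q k.+1 * s + 2 * delta K].
Proof.
move=> B0 GB covG delta0 q0 mp.
have bG f : G f -> bounded_mfun f.
  by move=> /GB[mf fB]; exact: bounded_mfun_range fB.
pose c k := projT1 (cid (covG k)).
have cP k : (forall i, G (c k i)) /\
    forall l, G l -> exists i, forall x, `|l x - c k i x| <= delta k.
  exact: projT2 (cid (covG k)).
(* Only the centers of level [K] need a probabilistic bound: replacing [f] by its center changes the
   deviation by at most [2 * delta K], whatever the sample. *)
suff [E [mE QE EP]] : exists E : set Om, [/\ measurable E,
    (Q (~` E) <= (\sum_(k < K.+1) p k)%:E)%E &
    forall w, E w -> forall i, deviation w (c K i) <=
      B * q 0%N * s + \sum_(k < K) 2 * delta k * q k.+1 * s].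
  exists E; split => // w Ew f Gf; have [i fi] := (cP K).2 _ Gf.
  have bc := bG _ ((cP K).1 i).
  have := EP _ Ew i; rewrite -(lerD2r (2 * delta K)); apply: le_trans.
  rewrite -lerBlDl -deviationB //; last exact: bG.
  by apply: deviation_le => //; apply: bounded_mfunB => //; exact: bG.
elim: K => [|K [E [mE QE EP]]].
  have [||E [mE QE EP]] := @deviation_family _ (c 0%N) B (q 0%N) B0 (q0 0%N).
  - by move=> i; apply: bG; case: (cP 0%N).
  - move=> i; exists 0 => x; rewrite add0r; apply: (GB _ _).2.
    by case: (cP 0%N).
  exists E; split => //.
    by apply: (le_trans QE); rewrite lee_fin big_ord_recl big_ord0 addr0.
  by move=> w Ew i; rewrite big_ord0 addr0; exact: EP.
have /choice[j jP] (i : 'I_(m K.+1)) : exists j,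
    forall x, `|c K.+1 i x - c K j x| <= delta K.
  by apply: (cP K).2; case: (cP K.+1).
have bc k i : bounded_mfun (c k i) by apply: bG; case: (cP k).
have dK0 : 0 <= 2 * delta K by rewrite mulr_ge0.
have [||E' [mE' QE' EP']] := @deviation_family _
    (fun i x => c K.+1 i x - c K (j i) x) _ (q K.+1) dK0 (q0 K.+1).
- by move=> i; exact: bounded_mfunB.
- move=> i; exists (- delta K) => x; have := jP i x; rewrite ler_norml; lra.
exists (E `&` E'); split; first exact: measurableI.
  rewrite setCI big_ord_recr EFinD.
  apply: (@le_trans _ _ (Q (~` E) + Q (~` E'))%E).
    by apply: measureU2; exact: measurableC.
  apply: leeD => //; apply: (le_trans QE'); rewrite lee_fin; exact: mp.
move=> w [Ew E'w] i; have := EP _ Ew (j i); have := EP' _ E'w i.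
by rewrite deviationB // big_ord_recr /=; lra.
Qed.

End Chaining.

(** [S] holds pairs of cost and value, and [V] bounds the values within budget [A]. Convexity puts
    every chord slope to the right of [(A, V)] below every chord slope to its left, so some line
    through this point lies above [S]. The left chord from [(0, r0)] caps its slope. *)
Lemma supergradient {R : realType} (S : set (R * R)) (A V M r0 : R) :
  0 < A -> S (0, r0) -> (forall x, S x -> 0 <= x.1 /\ x.2 <= M) ->
  (forall t x y, 0 <= t <= 1 -> S x -> S y ->
     S (t * x.1 + (1 - t) * y.1, t * x.2 + (1 - t) * y.2)) ->
  (forall x, S x -> x.1 <= A -> x.2 <= V) ->
  exists2 lam : R, 0 <= lam <= (V - r0) / A &
    forall x, S x -> x.2 <= V + lam * (x.1 - A).
Proof.
move=> A0 S0 SM Sconv SV.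
(* Slopes from [(A, V)] to the points beyond the budget; [0] makes [T] nonempty and its supremum
   non-negative. *)
pose T := [set 0] `|` [set (x.2 - V) / (x.1 - A) | x in S `&` [set x | A < x.1]].
have T0 : T 0 by left.
have slope x : S x -> x.1 < A -> ubound T ((V - x.2) / (A - x.1)).
  move=> Sx xA _ [->|[y [Sy /= yA] <-]].
    by rewrite divr_ge0 ?subr_ge0 ?SV // ltW.
  rewrite ler_pdivrMr ?subr_gt0 // mulrAC ler_pdivlMr ?subr_gt0 //.
  (* The weight for which the mixture of [x] and [y] spends exactly [A]. *)
  pose t := (y.1 - A) / (y.1 - x.1).
  have yx : 0 < y.1 - x.1 by lra.
  have t01 : 0 <= t <= 1.
    by rewrite /t divr_ge0 ?ler_pdivrMr //=; lra.
  have tE : t * (y.1 - x.1) = y.1 - A by rewrite divfK // gt_eqF.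
  have := SV _ (Sconv t x y t01 Sx Sy) => /=.
  have -> : t * x.1 + (1 - t) * y.1 = y.1 - t * (y.1 - x.1) by ring.
  have -> : y.1 - t * (y.1 - x.1) = A by rewrite tE; ring.
  move=> /(_ (lexx A)); rewrite -(ler_pM2r yx).
  have -> : (t * x.2 + (1 - t) * y.2) * (y.1 - x.1) =
     t * (y.1 - x.1) * (x.2 - y.2) + y.2 * (y.1 - x.1) by ring.
  by rewrite tE; lra.
have ub0 : ubound T ((V - r0) / A) by have := slope _ S0 A0; rewrite /= subr0.
have hsT : has_sup T by split; [exists 0|exists ((V - r0) / A)].
exists (sup T).
  apply/andP; split; first exact: (ub_le_sup hsT.2).
  by apply: ge_sup => //; exists 0.
move=> x Sx; have [xA|xA|xA] := ltgtP x.1 A.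
- have : sup T <= (V - x.2) / (A - x.1).
    by apply: ge_sup; [exists 0|exact: slope].
  by rewrite ler_pdivlMr ?subr_gt0 //; lra.
- have : (x.2 - V) / (x.1 - A) <= sup T.
    by apply: (ub_le_sup hsT.2); right; exists x.
  by rewrite ler_pdivrMr ?subr_gt0 //; lra.
- by rewrite xA subrr mulr0 addr0 SV // xA.
Qed.

(** * Measurability derived from the metric *)

Section MetricMeasurability.
Context {R : realType} {dZ : measure_display} {Z : measurableType dZ}.
Variable d : Z -> Z -> R.
Hypothesis hpolish : polish_metric d.
Hypothesis hborel : @measurable _ Z = <<s [set A | d_open d A] >>.

Let d_ge0 x y : 0 <= d x y. Proof. by case: hpolish => -[]. Qed.
Let dC x y : d x y = d y x. Proof. by case: hpolish => -[_ [_ []]]. Qed.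
Let dD x y u : d x u <= d x y + d y u.
Proof. by case: hpolish => -[_ [_ [_ +]]] _; apply. Qed.

Lemma dist_self x : d x x = 0.
Proof. by case: hpolish => -[_ [+ _]] _ => /(_ x x)[_ ->]. Qed.

Lemma lipschitz_measurable (f : Z -> R) (C : R) :
  (forall x y, f x - f y <= C * d x y) -> measurable_fun setT f.
Proof.
move=> fC; apply: (measurability _ (RGenOInfty.measurableE R)) => //.
move=> _ [_ [c ->] <-]; rewrite setTI hborel; apply: sub_sigma_algebra => /= x.
rewrite /= in_itv /= andbT => cfx.
pose e := (f x - c) / (`|C| + 1).
have C1 : 0 < `|C| + 1 by rewrite ltr_wpDl.
exists e; first by rewrite divr_gt0 // subr_gt0.
move=> y dxy; rewrite in_itv /= andbT.
have h1 : C * d x y <= `|C| * d x y by rewrite ler_wpM2r // ler_norm.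
have h2 : (`|C| + 1) * d x y < f x - c by rewrite mulrC -ltr_pdivlMr.
have := fC x y; have := d_ge0 x y; lra.
Qed.

Lemma dense_sequence : exists e : nat -> Z,
  forall x (c : R), 0 < c -> exists n, d x (e n) < c.
Proof.
have [_ [_ [S [cS dS]]]] := hpolish.
have [S0|[g]] := pfcard_geP cS.
  by have [y] := dS point 1 ltr01; rewrite S0.
exists (fun n => g n) => x c c0; have [y Sy dxy] := dS x c c0.
by have [n _ gn] := 'surj_g Sy; exists n; rewrite gn.
Qed.

(** The product sigma-algebra is generated by rectangles, so continuity of the distance does not
    conclude directly; separability writes [d x y < c] as a countable union of conditions on the
    distances of [x] and [y] to a common dense point. *)
Lemma measurable_dist : measurable_fun setT (fun p : Z * Z => d p.1 p.2).
Proof.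
have [e eP] := dense_sequence.
apply: (measurability _ (RGenInftyO.measurableE R)) => //.
move=> _ [_ [c ->] <-]; rewrite setTI.
have md n : measurable_fun setT (fun x => d x (e n)).
  apply: (@lipschitz_measurable _ 1) => x y.
  by have := dD x y (e n); lra.
rewrite (_ : _ @^-1` _ = \bigcup_n [set p | d p.1 (e n) + d p.2 (e n) < c]).
  apply: bigcup_measurable => n _.
  have mf : measurable_fun setT (fun p : Z * Z => d p.1 (e n) + d p.2 (e n)).
    apply: measurable_funD.
      exact: (measurableT_comp (md n) measurable_fst).
    exact: (measurableT_comp (md n) measurable_snd).
  by have := mf measurableT _ (measurable_itv `]-oo, c[); rewrite set_itvNyo setTI.
apply/seteqP; split => [[x y]|[x y] [n _ /=]]; rewrite /= in_itv /=.
  move=> xyc; have [n] := eP x ((c - d x y) / 2) ltac:(lra).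
  by exists n => //=; have := dD y x (e n); rewrite (dC y x); lra.
by have := dD x (e n) y; rewrite (dC (e n) y); lra.
Qed.

Hypothesis hdiam : finite_diam d.

Lemma dist_le_diam x y : d x y <= diam d.
Proof.
have [M dM] := hdiam; apply: ub_le_sup; last by exists (x, y).
by exists M => _ [p _ <-].
Qed.

Lemma diam_ge0 : 0 <= diam d.
Proof. exact: le_trans (d_ge0 point point) (dist_le_diam _ _). Qed.

Lemma bounded_mfun_dist2 : bounded_mfun (fun p : Z * Z => d p.1 p.2 ^+ 2).
Proof.
apply: bounded_mfun_sqr; apply: (@bounded_mfun_range _ _ _ _ 0 (diam d) measurable_dist).
by move=> p; rewrite d_ge0 dist_le_diam.
Qed.

End MetricMeasurability.

(** * Dual losses and weak duality *)

Section Duality.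
Context {R : realType} {dZ : measure_display} {Z : measurableType dZ}.
Variable d : Z -> Z -> R.
Hypothesis hpolish : polish_metric d.
Hypothesis hborel : @measurable _ Z = <<s [set A | d_open d A] >>.
Hypothesis hdiam : finite_diam d.

Let d_ge0 x y : 0 <= d x y. Proof. by case: hpolish => -[]. Qed.
Let dC x y : d x y = d y x. Proof. by case: hpolish => -[_ [_ []]]. Qed.
Let dD x y u : d x u <= d x y + d y u.
Proof. by case: hpolish => -[_ [_ [_ +]]] _; apply. Qed.
Let d_le x y : d x y <= diam d. Proof. exact: dist_le_diam. Qed.

(** The c-transform of [l] for the transport cost [lam * d x y ^+ 2]. *)
Definition dual_loss (lam : R) (l : Z -> R) (x : Z) : R :=
  sup [set l y - lam * d x y ^+ 2 | y in [set: Z]].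

Section Loss.
Variables (B : R) (l : Z -> R).
Hypothesis lB : forall x, 0 <= l x <= B.

Lemma dual_loss_has_sup lam x : 0 <= lam ->
  has_sup [set l y - lam * d x y ^+ 2 | y in [set: Z]].
Proof.
move=> lam0; split; first by exists (l x - lam * d x x ^+ 2), x.
exists B => _ [y _ <-]; rewrite lerBlDr ler_wpDr //; last by case/andP: (lB y).
by rewrite mulr_ge0 ?sqr_ge0.
Qed.

Lemma dual_loss_ub lam x y : 0 <= lam ->
  l y - lam * d x y ^+ 2 <= dual_loss lam l x.
Proof.
by move=> lam0; apply: (ub_le_sup (dual_loss_has_sup x lam0).2); exists y.
Qed.

Lemma dual_loss_le lam x (c : R) : (forall y, l y - lam * d x y ^+ 2 <= c) ->
  dual_loss lam l x <= c.
Proof.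
move=> h; apply: ge_sup; last by move=> _ [y _ <-].
by exists (l x - lam * d x x ^+ 2), x.
Qed.

Lemma dual_loss_range lam x : 0 <= lam -> 0 <= dual_loss lam l x <= B.
Proof.
move=> lam0; apply/andP; split.
  have := dual_loss_ub x x lam0.
  rewrite (dist_self hpolish) expr0n mulr0 subr0; apply: le_trans.
  by case/andP: (lB x).
apply: dual_loss_le => y; rewrite lerBlDr ler_wpDr //; last by case/andP: (lB y).
by rewrite mulr_ge0 ?sqr_ge0.
Qed.

(** On a bounded space the penalty is Lipschitz in [x] uniformly in the competitor; this is how a
    supremum over uncountably many competitors becomes measurable. *)
Lemma dual_loss_lipschitz lam x y : 0 <= lam ->
  dual_loss lam l x - dual_loss lam l y <= 2 * lam * diam d * d x y.
Proof.
move=> lam0; rewrite lerBlDr; apply: dual_loss_le => u.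
have := dual_loss_ub y u lam0.
have h : d y u ^+ 2 - d x u ^+ 2 <= 2 * diam d * d x y.
  have := dD y x u; have := d_le x u; have := d_le y u; rewrite (dC y x).
  have := d_ge0 x u; have := d_ge0 x y; have := d_ge0 y u; have := dD x y u.
  have := diam_ge0 hpolish hdiam. nra.
have := ler_wpM2l lam0 h; lra.
Qed.

Lemma bounded_mfun_dual_loss lam : 0 <= lam -> bounded_mfun (dual_loss lam l).
Proof.
move=> lam0; apply: (@bounded_mfun_range _ _ _ _ 0 B).
  apply: (lipschitz_measurable hpolish hborel) => x y.
  exact: dual_loss_lipschitz.
by move=> x; exact: dual_loss_range.
Qed.

End Loss.

(** Compare at a common competitor: raising the multiplier from [lam] to [lam'] loses at most
    [(lam' - lam) * diam d ^+ 2], and lowering it loses nothing. *)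
Lemma dual_loss_perturb (B : R) (l l' : Z -> R) (lam lam' v v' : R) :
  (forall x, 0 <= l' x <= B) -> 0 <= lam' ->
  (forall x, l x - l' x <= v) -> (lam' - lam) * diam d ^+ 2 <= v' -> 0 <= v' ->
  forall x, dual_loss lam l x - dual_loss lam' l' x <= v + v'.
Proof.
move=> l'B lam'0 lv lamv v'0 x; rewrite lerBlDr; apply: dual_loss_le => y.
have := dual_loss_ub l'B x y lam'0; have := lv y.
have : (lam' - lam) * d x y ^+ 2 <= v'.
  have [h|h] := leP 0 (lam' - lam).
    by apply: le_trans lamv; rewrite ler_wpM2l // ler_sqr ?nnegrE // diam_ge0.
  by apply: le_trans v'0; rewrite mulr_le0_ge0 ?sqr_ge0 // ltW.
lra.
Qed.

Lemma coupling_mean_fst (mu : probability Z R) (g : probability (Z * Z)%type R)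
    (f : Z -> R) :
  (forall A, measurable A -> g (A `*` [set: Z]) = mu A) -> bounded_mfun f ->
  mean g (fun p => f p.1) = mean mu f.
Proof.
move=> gmu bf; have [nu [nuE nuM]] := probability_pushforward g measurable_fst.
rewrite -nuM // /mean /Rintegral; congr fine; apply: eq_measure_integral => A mA _.
transitivity (g (A `*` setT)); last exact: gmu.
rewrite [LHS]nuE; congr (g _).
by apply/seteqP; split => [[x y]|[x y] []].
Qed.

Lemma coupling_mean_snd (nu : probability Z R) (g : probability (Z * Z)%type R)
    (f : Z -> R) :
  (forall A, measurable A -> g ([set: Z] `*` A) = nu A) -> bounded_mfun f ->
  mean g (fun p => f p.2) = mean nu f.
Proof.
move=> gnu bf; have [m [mE mM]] := probability_pushforward g measurable_snd.
rewrite -mM // /mean /Rintegral; congr fine; apply: eq_measure_integral => A mA _.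
transitivity (g (setT `*` A)); last exact: gnu.
rewrite [LHS]mE; congr (g _).
by apply/seteqP; split => [[x y]|[x y] []].
Qed.

Lemma dro_risk_weak_duality (mu : probability Z R) (alpha lam B : R) (l : Z -> R) :
  (forall x, 0 <= l x <= B) -> measurable_fun setT l -> 0 <= lam ->
  (dro_risk d mu alpha l <= (lam * alpha ^+ 2 + mean mu (dual_loss lam l))%:E)%E.
Proof.
move=> lB ml lam0; apply: ge_ereal_sup => _ [Q WQ <-].
have bl := bounded_mfun_range ml lB.
rewrite integral_mean // lee_fin; apply/ler_addgt0Pl => e e0.
(* Room for a near-optimal coupling: multiplied by [lam], this slack stays below [e]; the [+ 1]
   covers [lam = 0]. *)
have e'0 : 0 < e / (lam + 1) by rewrite divr_gt0 // ltr_wpDl.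
have : (W2sq d mu Q < (alpha ^+ 2 + e / (lam + 1))%:E)%E.
  by apply: le_lt_trans WQ _; rewrite lte_fin ltrDl.
rewrite /W2sq => /ereal_inf_lt[_ [g gcpl <-]].
have bd := bounded_mfun_dist2 hpolish hborel hdiam.
rewrite integral_mean // lte_fin => gd.
have g1 A : measurable A -> g (A `*` [set: Z]) = mu A by move=> mA; case: (gcpl A mA).
have g2 A : measurable A -> g ([set: Z] `*` A) = Q A by move=> mA; case: (gcpl A mA).
have bphi := bounded_mfun_dual_loss lB lam0.
rewrite -(coupling_mean_snd g2) // -(coupling_mean_fst g1) //.
have b1 : bounded_mfun (fun p : Z * Z => dual_loss lam l p.1).
  exact: (bounded_mfun_comp measurable_fst).
apply: (@le_trans _ _ (mean g (fun p => dual_loss lam l p.1 + lam * d p.1 p.2 ^+ 2))).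
  apply: le_mean; first exact: (bounded_mfun_comp measurable_snd).
    by apply: bounded_mfunD => //; exact: bounded_mfunZ.
  by move=> [x y] /=; rewrite -lerBlDr (dual_loss_ub lB).
rewrite meanD ?meanZ //; last exact: bounded_mfunZ.
have h1 : lam * mean g (fun p => d p.1 p.2 ^+ 2) <= lam * (alpha ^+ 2 + e / (lam + 1)).
  by rewrite ler_wpM2l // ltW.
have h2 : lam * (e / (lam + 1)) <= e.
  by rewrite mulrCA ger_pMr // ler_pdivrMr ?mul1r ?lerDl ?ltr_wpDl.
lra.
Qed.

End Duality.

(** [T x] is [e n] for the first [n] that qualifies, so each preimage is a countable union of
    differences of measurable sets. *)
Lemma measurable_selection {R : realType} {dZ : measure_display}
    {Z : measurableType dZ} (h : nat -> Z -> R) (f : Z -> R) (e : nat -> Z) :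
  (forall n, measurable_fun setT (h n)) -> measurable_fun setT f ->
  (forall x, exists n, f x < h n x) ->
  exists T : Z -> Z, measurable_fun setT T /\
    forall x, exists n, T x = e n /\ f x < h n x.
Proof.
move=> mh mf fh.
pose P n := [set x | f x < h n x].
have mP n : measurable (P n).
  have := (measurable_funB (mh n) mf) measurableT _ (measurable_itv `]0, +oo[).
  rewrite setTI; congr measurable; apply/seteqP.
  by split => x; rewrite /P /= in_itv /= andbT subr_gt0.
have exk x : exists n, `[< P n x >] by have [n] := fh x; exists n; apply/asboolP.
pose k x := ex_minn (exk x).
have kP x : P (k x) x by rewrite /k; case: ex_minnP => n /asboolP.
have kE n x : k x = n <-> (P n `\` \bigcup_(m in [set m | (m < n)%N]) P m) x.
  split=> [<-|[Pn nP]].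
    split=> // -[m /= + Pm]; rewrite /k; case: ex_minnP => n' _ /(_ m).
    by move=> /(_ (asboolT Pm)); rewrite leqNgt => /negP.
  rewrite /k; case: ex_minnP => n' /asboolP Pn' /(_ n (asboolT Pn)) n'n.
  apply/eqP; rewrite eqn_leq n'n leqNgt /=; apply/negP => lt; apply: nP.
  by exists n'.
exists (fun x => e (k x)); split; last by move=> x; exists (k x); split => //; exact: kP.
move=> _ A mA; rewrite setTI.
rewrite (_ : _ @^-1` _ = \bigcup_(n in [set n | A (e n)])
    (P n `\` \bigcup_(m in [set m | (m < n)%N]) P m)).
  apply: bigcup_measurable => n _; apply: measurableD => //.
  by apply: bigcup_measurable.
apply/seteqP; split => [x /= Ax|x [n An /kE kx]]; last by rewrite /= kx.
by exists (k x) => //; apply/kE.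
Qed.

(** * Strong duality with a bounded multiplier *)

Section StrongDuality.
Context {R : realType} {dZ : measure_display} {Z : measurableType dZ}.
Variable d : Z -> Z -> R.
Hypothesis hpolish : polish_metric d.
Hypothesis hborel : @measurable _ Z = <<s [set A | d_open d A] >>.
Hypothesis hdiam : finite_diam d.

Let d_ge0 x y : 0 <= d x y. Proof. by case: hpolish => -[]. Qed.
Let dC x y : d x y = d y x. Proof. by case: hpolish => -[_ [_ []]]. Qed.
Let dD x y u : d x u <= d x y + d y u.
Proof. by case: hpolish => -[_ [_ [_ +]]] _; apply. Qed.

(** A near-maximizer is moved to a point of a dense sequence. Half of [e] pays for near-optimality
    and half for the move, the objective being Lipschitz in the competitor with constant
    [L + 2 * lam * diam d]. *)
Lemma dual_loss_selection (B L lam e : R) (l : Z -> R) :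
  (forall x, 0 <= l x <= B) -> 0 <= L ->
  (forall x y, l y - l x <= L * d x y) -> 0 <= lam -> 0 < e ->
  exists T : Z -> Z, measurable_fun setT T /\
    forall x, dual_loss d lam l x - e <= l (T x) - lam * d x (T x) ^+ 2.
Proof.
move=> lB L0 lL lam0 e0.
have [s sP] := dense_sequence hpolish.
have mdl := bounded_mfun_dual_loss hpolish hborel hdiam lB lam0.
have bcst := @bounded_mfun_cst R _ Z.
have [|||T [mT TP]] := @measurable_selection R _ Z
    (fun n x => l (s n) - lam * d x (s n) ^+ 2) (fun x => dual_loss d lam l x - e) s.
- move=> n; apply: measurable_funB => //; apply: measurable_funM => //.
  apply: measurable_funX; apply: (@lipschitz_measurable _ _ _ d hpolish hborel _ 1).
  by move=> x y; have := dD x y (s n); lra.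
- exact: (bounded_mfunB mdl (bcst e)).1.
- move=> x.
  have [_ [y _ <-] hy] := @sup_adherent _ _ (e / 2) ltac:(by rewrite divr_gt0)
    (dual_loss_has_sup d lB x lam0).
  pose D := diam d; have D0 : 0 <= D by exact: diam_ge0.
  have C0 : 0 < L + 2 * lam * D + 1 by rewrite ltr_wpDl // addr_ge0 ?mulr_ge0.
  have [n ny] := sP y (e / 2 / (L + 2 * lam * D + 1)) ltac:(by rewrite !divr_gt0).
  exists n; move: ny; rewrite ltr_pdivlMr // => ny.
  have h1 := lL (s n) y; rewrite (dC _ y) in h1.
  have h2 : d x (s n) ^+ 2 - d x y ^+ 2 <= 2 * D * d y (s n).
    have := dD x y (s n); have := dist_le_diam hdiam x (s n).
    have := dist_le_diam hdiam x y; rewrite -/D.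
    have := d_ge0 x y; have := d_ge0 x (s n); have := d_ge0 y (s n).
    have := dD x (s n) y; rewrite (dC (s n) y); nra.
  have h3 := ler_wpM2l lam0 h2; have := d_ge0 y (s n); rewrite /dual_loss; lra.
exists T; split => // x; have [n [-> /ltW]] := TP x; lra.
Qed.

(** Maximizing the mean loss over couplings of cost at most [alpha ^+ 2] is a linear problem on a
    convex set, so a supporting multiplier exists even when no optimal coupling does. *)
Lemma dro_risk_strong_duality (mu : probability Z R) (alpha B L : R) (l : Z -> R) :
  (forall x, 0 <= l x <= B) -> 0 <= L ->
  (forall x y, l y - l x <= L * d x y) -> 0 < alpha ->
  exists2 lam : R, 0 <= lam <= L / alpha &
    ((lam * alpha ^+ 2 + mean mu (dual_loss d lam l))%:E <= dro_risk d mu alpha l)%E.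
Proof.
move=> lB L0 lL a0.
have ml : measurable_fun setT l.
  by apply: (@lipschitz_measurable _ _ _ d hpolish hborel _ L) => x y; rewrite dC.
have bl := bounded_mfun_range ml lB.
have bd := bounded_mfun_dist2 hpolish hborel hdiam.
have bl2 : bounded_mfun (fun p : Z * Z => l p.2).
  exact: (bounded_mfun_comp measurable_snd).
have bl1 : bounded_mfun (fun p : Z * Z => l p.1).
  exact: (bounded_mfun_comp measurable_fst).
pose S : set (R * R) := [set x | exists g : probability (Z * Z)%type R,
  [/\ forall A, measurable A -> g (A `*` [set: Z]) = mu A,
      x.1 = mean g (fun p => d p.1 p.2 ^+ 2) & x.2 = mean g (fun p => l p.2)]].
have Spush (T : Z -> Z) : measurable_fun setT T ->
    S (mean mu (fun x => d x (T x) ^+ 2), mean mu (fun x => l (T x))).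
  move=> mT; have mp : measurable_fun setT (fun x => (x, T x)).
    exact: measurable_fun_pair.
  have [g [gE gM]] := probability_pushforward mu mp; exists g; split.
  - by move=> A mA; rewrite gE; congr (mu _); apply/seteqP; split => [x []|].
  - by rewrite gM.
  - by rewrite gM.
have S0 : S (0, mean mu l).
  have := Spush id (@measurable_id _ _ _); congr (S (_, _)).
  by rewrite (eq_mean _ (g := fun=> 0)) ?mean_cst // => x; rewrite dist_self // expr0n.
have Sb x : S x -> 0 <= x.1 /\ x.2 <= B.
  move=> [g [_ -> ->]]; split.
    by apply: mean_ge_cst => // p; exact: sqr_ge0.
  by apply: mean_le_cst => // p; case/andP: (lB p.2).
have Sconv t x y : 0 <= t <= 1 -> S x -> S y ->
     S (t * x.1 + (1 - t) * y.1, t * x.2 + (1 - t) * y.2).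
  move=> t01 [g [g1 -> ->]] [g' [g'1 -> ->]].
  have [m [mE mM]] := probability_mixture t01 g g'; exists m; split.
  - move=> A mA; rewrite mE g1 // g'1 // -muleDl ?fin_num_adde_defl //.
      by rewrite -EFinD addrC subrK mul1e.
    by rewrite fin_num_measure.
  - by rewrite mM.
  - by rewrite mM.
pose v := fine (dro_risk d mu alpha l).
have drob x : S x -> x.1 <= alpha ^+ 2 -> (x.2%:E <= dro_risk d mu alpha l)%E.
  move=> [g [g1 -> ->]] ga.
  have [nu [nuE nuM]] := probability_pushforward g measurable_snd.
  apply: ereal_sup_ubound; exists nu; last by rewrite integral_mean // nuM.
  apply: (@le_trans _ _ (mean g (fun p => d p.1 p.2 ^+ 2))%:E) => //.
  apply: ereal_inf_lbound; exists g; last by rewrite integral_mean.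
  move=> A mA; split; first exact: g1.
  rewrite nuE; congr (g _).
  by apply/seteqP; split => [[x' y] []|[x' y]].
have drofin : dro_risk d mu alpha l = v%:E.
  rewrite /v fineK // fin_numElt; apply/andP; split.
    apply: lt_le_trans (drob _ S0 _); first exact: ltNyr.
    exact: sqr_ge0.
  apply: (@le_lt_trans _ _ B%:E); last exact: ltry.
  apply: ge_ereal_sup => _ [Q _ <-]; rewrite integral_mean // lee_fin.
  by apply: mean_le_cst => // x; case/andP: (lB x).
pose V := sup [set x.2 | x in S `&` [set x | x.1 <= alpha ^+ 2]].
have hsV : has_sup [set x.2 | x in S `&` [set x | x.1 <= alpha ^+ 2]].
  split; first by exists (mean mu l), (0, mean mu l) => //; split => //=; exact: sqr_ge0.
  by exists B => _ [x [/Sb[_ h] _] <-].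
have [||lam /andP[lam0 lamV] lamP] :=
    @supergradient R S (alpha ^+ 2) V B (mean mu l) _ S0 Sb Sconv.
- exact: exprn_gt0.
- by move=> x Sx xa; apply: (ub_le_sup hsV.2); exists x.
(* Turns the slope bound [(V - mean mu l) / alpha ^+ 2] of [supergradient] into [L / alpha]. *)
have VL : V <= mean mu l + L * alpha.
  apply: ge_sup hsV.1 _ => _ [x [[g [g1 xE ->]] /= xa] <-].
  rewrite -(coupling_mean_fst g1) // addrC -lerBlDr -meanB //.
  pose c := L / (2 * alpha).
  have c0 : 0 <= c by rewrite divr_ge0 // mulr_ge0 // ltW.
  apply: (@le_trans _ _ (mean g (fun p => c * d p.1 p.2 ^+ 2 + L * alpha / 2))).
    apply: le_mean; first exact: bounded_mfunB.
      by apply: bounded_mfunD; [exact: bounded_mfunZ|exact: bounded_mfun_cst].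
    (* AM-GM: [d <= (d ^+ 2 / alpha + alpha) / 2] *)
    move=> [x' y'] /=; apply: (le_trans (lL x' y')).
    set t := d x' y'; rewrite -subr_ge0.
    have -> : c * t ^+ 2 + L * alpha / 2 - L * t = c * (t - alpha) ^+ 2.
      by rewrite /c; field; rewrite gt_eqF.
    by rewrite mulr_ge0 ?sqr_ge0.
  rewrite meanD; [|exact: bounded_mfunZ|exact: bounded_mfun_cst].
  rewrite meanZ // mean_cst.
  have : c * mean g (fun p => d p.1 p.2 ^+ 2) <= c * alpha ^+ 2.
    by rewrite ler_wpM2l // -xE.
  have -> : c * alpha ^+ 2 = L * alpha / 2 by rewrite /c; field; rewrite gt_eqF.
  by rewrite -/c; lra.
exists lam.
  rewrite lam0 /=; apply: (le_trans lamV).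
  rewrite ler_pdivrMr ?exprn_gt0 //.
  have -> : L / alpha * alpha ^+ 2 = L * alpha by field; rewrite gt_eqF.
  by lra.
have Vv : V <= v.
  apply: ge_sup hsV.1 _ => _ [x [Sx xa] <-].
  by rewrite -lee_fin -drofin; exact: drob.
rewrite drofin lee_fin; apply: le_trans Vv; apply/ler_addgt0Pl => e e0.
(* Evaluated at the coupling that moves [x] to the near-maximizer [T x], the supporting line becomes
   the dual objective up to [e]. *)
have [T [mT TP]] := dual_loss_selection lB L0 lL lam0 e0.
have /= hT := lamP _ (Spush T mT).
have mp : measurable_fun setT (fun x => (x, T x)) by exact: measurable_fun_pair.
have bdT : bounded_mfun (fun x => d x (T x) ^+ 2).
  exact: (bounded_mfun_comp mp bd).
have blT : bounded_mfun (fun x => l (T x)) by exact: (bounded_mfun_comp mT).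
have bphi := bounded_mfun_dual_loss hpolish hborel hdiam lB lam0.
have : mean mu (fun x => dual_loss d lam l x - e) <=
    mean mu (fun x => l (T x) - lam * d x (T x) ^+ 2).
  apply: le_mean => //.
    by apply: bounded_mfunB => //; exact: bounded_mfun_cst.
  by apply: bounded_mfunB => //; exact: bounded_mfunZ.
rewrite (@meanB _ _ _ _ (dual_loss d lam l)) ?mean_cst //; last exact: bounded_mfun_cst.
rewrite (@meanB _ _ _ _ (fun x => l (T x))) ?meanZ //; last exact: bounded_mfunZ.
by lra.
Qed.

End StrongDuality.

(** * Covering numbers and the entropy integral *)

Section Entropy.
Context {R : realType}.

(** A lower Riemann sum over the cells []v k.+1, v k]], some of which may be empty; [f] may take the
    value [+oo]. *)
Lemma nonincreasing_integral_ge (f : R -> \bar R) (v a : nat -> R) (K : nat) :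
  (forall x, (0 <= f x)%E) -> (forall x y, x <= y -> (f y <= f x)%E) ->
  (forall k, 0 <= v k) -> (forall k, v k.+1 <= v k) -> (forall k, 0 <= a k) ->
  (forall k, 0 < v k -> ((a k)%:E <= f (v k))%E) ->
  ((\sum_(k < K) (v k - v k.+1) * a k)%:E <=
     \int[@lebesgue_measure R]_(x in [set x : R | (0 < x)%R]) f x)%E.
Proof.
move=> f0 fmono v0 vS a0 af.
have mf (D : set R) : measurable D -> measurable_fun D f.
  move=> mD; apply: (measurability (@ErealGenCInfty.G R)) => [|/= _ [_] [r] -> <-].
    exact: ErealGenCInfty.measurableE.
  apply: measurableI => //; apply: is_interval_measurable => s t /=.
  rewrite !in_itv /= !andbT => fs ft u /andP[su ut].
  by rewrite in_itv /= andbT (le_trans ft) // fmono.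
have pos : [set x : R | 0 < x] = `]0, +oo[%classic by rewrite set_itvoy.
rewrite pos.
apply: (@le_trans _ _ (\int[@lebesgue_measure R]_(x in `]v K, v 0%N]) f x)%E);
  last first.
  apply: ge0_subset_integral => //; first exact: mf.
  by move=> x /=; rewrite !in_itv /= => /andP[vx _]; rewrite (le_lt_trans (v0 K)).
have v0K k : v k <= v 0%N.
  by elim: k => // k; exact: le_trans (vS k).
elim: K => [|K IH].
  by rewrite big_ord0; exact: integral_ge0.
have -> : `]v K.+1, v 0%N]%classic = `]v K.+1, v K] `|` `]v K, v 0%N].
  by apply: itv_bndbnd_setU; rewrite bnd_simp.
rewrite ge0_integral_setU //; last 2 first.
- by apply: mf; exact: measurableU.
- apply/disj_setPS => x [] /=; rewrite !in_itv /= => /andP[_ xK] /andP[Kx _].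
  by move: Kx; rewrite ltNge xK.
rewrite big_ord_recr /= EFinD addeC; apply: leeD => //.
apply: (@le_trans _ _ (\int[@lebesgue_measure R]_(x in `]v K.+1, v K]) (a K)%:E)%E).
  rewrite integral_cst //= lebesgue_measure_itv /= lte_fin.
  case: ltP => h; first by rewrite -EFinB -EFinM mulrC.
  by rewrite mule0 (_ : v K - v K.+1 = 0) ?mul0r //; apply/eqP; rewrite subr_eq0 eq_le h vS.
apply: ge0_le_integral => //; [by move=> x _; rewrite lee_fin|exact: mf|].
move=> x /=; rewrite in_itv /= => /andP[Kx xK].
apply: (le_trans (af K _)); last exact: fmono.
exact: le_lt_trans (v0 _) (lt_le_trans Kx xK).
Qed.

Context {Z : Type}.
Variable F : set (Z -> R).
Hypothesis F0 : F !=set0.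

Lemma has_cover_gt0 v n : has_cover F v n -> (0 < n)%N.
Proof.
move=> [c [_ cP]]; have [l Fl] := F0; have [i _] := cP l Fl.
exact: leq_ltn_trans (leq0n i) (ltn_ord i).
Qed.

Lemma has_cover_le v v' n : v <= v' -> has_cover F v n -> has_cover F v' n.
Proof.
move=> vv' [c [Fc cP]]; exists c; split => // l /cP[i ci].
by exists i => x; apply: le_trans vv'.
Qed.

(** A finite covering number is attained, being a minimum of naturals; its positivity, from [F]
    nonempty, makes its logarithm non-negative. *)
Variant covering_number_spec v : \bar R -> Prop :=
  | CoveringNumberFinite n of has_cover F v n & (0 < n)%N :
      covering_number_spec v (n%:R)%:E
  | CoveringNumberInfinite of (forall n, ~ has_cover F v n) :
      covering_number_spec v +oo%E.

Lemma covering_numberP v : covering_number_spec v (covering_number F v).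
Proof.
rewrite /covering_number; have [[n0 cn0]|nc] := pselect (exists n, has_cover F v n).
  have ex : exists n, `[< has_cover F v n >] by exists n0; apply/asboolP.
  case: (ex_minnP ex) => n /asboolP cn nmin.
  suff -> : ereal_inf [set (n%:R)%:E | n in [set n | has_cover F v n]] =
      (n%:R : R)%:E by apply: CoveringNumberFinite => //; exact: has_cover_gt0 cn.
  apply/le_anti/andP; split; first by apply: ereal_inf_lbound; exists n.
  by apply: le_ereal_inf_tmp => _ [m cm <-]; rewrite lee_fin ler_nat nmin //; apply/asboolP.
rewrite (_ : [set n | has_cover F v n] = set0) ?image_set0 ?ereal_inf0.
  by apply: CoveringNumberInfinite => n cn; apply: nc; exists n.
by rewrite -subset0 => n cn; apply: nc; exists n.
Qed.

Lemma covering_number_le v v' : v <= v' ->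
  (covering_number F v' <= covering_number F v)%E.
Proof.
move=> vv'; apply: ereal_inf_le_tmp => _ [n cn <-].
by exists n => //; exact: has_cover_le cn.
Qed.

Lemma entropy_integrand_ge0 v : (0 <= entropy_integrand F v)%E.
Proof.
by rewrite /entropy_integrand; case: covering_numberP => *;
  rewrite ?lee_fin ?sqrtr_ge0 ?leey.
Qed.

Lemma entropy_integrand_nonincreasing :
  forall x y, x <= y -> (entropy_integrand F y <= entropy_integrand F x)%E.
Proof.
move=> x y xy; have := covering_number_le xy; rewrite /entropy_integrand.
case: (covering_numberP y) => [n _ n0|_]; case: (covering_numberP x) => [m _ m0|_] //=.
- by rewrite !lee_fin => nm; rewrite ler_wsqrtr // ler_ln // posrE ltr0n.
- by move=> _; exact: leey.
Qed.

Lemma sum_entropy_le_dudley (v a : nat -> R) (K : nat) :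
  (forall k, 0 <= v k) -> (forall k, v k.+1 <= v k) -> (forall k, 0 <= a k) ->
  (forall k, 0 < v k -> ((a k)%:E <= entropy_integrand F (v k))%E) ->
  ((\sum_(k < K) (v k - v k.+1) * a k)%:E <= dudley_integral F)%E.
Proof.
apply: nonincreasing_integral_ge; first exact: entropy_integrand_ge0.
exact: entropy_integrand_nonincreasing.
Qed.

Lemma first_entropy_le_dudley (v a : R) : 0 < v -> 0 <= a ->
  (a%:E <= entropy_integrand F v)%E -> ((v * a)%:E <= dudley_integral F)%E.
Proof.
(* A single rectangle of width [v]: the scale drops to [0] after one step. *)
move=> v0 a0 av; pose w k := if k is 0%N then v else 0.
have := @sum_entropy_le_dudley w (fun=> a) 1.
rewrite big_ord_recl big_ord0 /= subr0 addr0; apply => //.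
- by case=> // ; exact: ltW.
- by case=> //=; exact: ltW.
- by case=> //= n; rewrite ltxx.
Qed.

(** An infinite covering number at [v] would let rectangles of width [v] and arbitrary height fit
    below the integrand. *)
Lemma dudley_finite_cover (v : R) : (dudley_integral F < +oo)%E -> 0 < v ->
  exists n, [/\ has_cover F v n, (0 < n)%N &
    entropy_integrand F v = (Num.sqrt (ln n%:R))%:E].
Proof.
move=> Jfin v0; have := @first_entropy_le_dudley v _ v0; rewrite /entropy_integrand.
case: covering_numberP => [n cn n0 _|_ h]; first by exists n.
have J0 : (0 <= dudley_integral F)%E.
  by have := h 0 (lexx 0) (leey _); rewrite mulr0.
have /fineK JE : dudley_integral F \is a fin_num by rewrite ge0_fin_numE.
have j0 : 0 <= fine (dudley_integral F) by exact: fine_ge0.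
have := h ((fine (dudley_integral F) + 1) / v) _ (leey _).
rewrite mulrCA divff ?gt_eqF // mulr1 -JE lee_fin /=.
by move=> /(_ ltac:(by rewrite divr_ge0 ?addr_ge0 ?(ltW v0))); lra.
Qed.

End Entropy.

(** * Covers of the class of dual losses *)

Section DualClass.
Context {R : realType} {dZ : measure_display} {Z : measurableType dZ}.
Variable d : Z -> Z -> R.
Hypothesis hpolish : polish_metric d.
Hypothesis hborel : @measurable _ Z = <<s [set A | d_open d A] >>.
Hypothesis hdiam : finite_diam d.

Definition dual_class (F : set (Z -> R)) (Lam : R) : set (Z -> R) :=
  [set f | exists lam l, [/\ 0 <= lam <= Lam, F l & f = dual_loss d lam l]].

(** One [v] pays for replacing the loss, the other for rounding the multiplier to a grid of step
    [v / diam d ^+ 2]. Rounding down keeps the nodes in [[0, Lam]], so the centers belong to the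
    class. *)
Lemma has_cover_dual_class (F : set (Z -> R)) (B Lam v : R) (n : nat) :
  (forall l, F l -> forall x, 0 <= l x <= B) -> 0 <= Lam -> 0 < v ->
  has_cover F v n ->
  has_cover (dual_class F Lam) (2 * v)
    (n * (Num.truncn (Lam * diam d ^+ 2 / v)).+1).
Proof.
move=> FB Lam0 v0 [c [Fc cP]]; set D2 := diam d ^+ 2.
set M := (Num.truncn (Lam * D2 / v)).+1.
have D20 : 0 <= D2 by rewrite sqr_ge0.
have M0 : (0 < M)%N by [].
have iM (i : 'I_(n * M)) : (i %/ M < n)%N by rewrite ltn_divLR.
(* If [D2 = 0], division by zero makes every node [0]; this is harmless, as the penalty vanishes
   too. *)
pose node (j : nat) : R := j%:R * v / D2.
have node0 j : 0 <= node j by rewrite /node divr_ge0 // mulr_ge0 // ltW.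
have nodeL (j : nat) : (j < M)%N -> node j <= Lam.
  move=> jM; have [D2E|D2n] := eqVneq D2 0; first by rewrite /node D2E invr0 mulr0.
  have D2p : 0 < D2 by rewrite lt_neqAle eq_sym D2n.
  rewrite /node ler_pdivrMr // -ler_pdivlMr //.
  apply: (@le_trans _ _ (Num.truncn (Lam * D2 / v))%:R); first by rewrite ler_nat.
  rewrite truncn_le; exact: divr_ge0 (mulr_ge0 Lam0 D20) (ltW v0).
(* The index encodes a pair: the quotient by [M] selects the loss, the remainder the multiplier. *)
exists (fun i : 'I_(n * M) => dual_loss d (node (i %% M)%N) (c (Ordinal (iM i)))); split.
  move=> i; exists (node (i %% M)%N), (c (Ordinal (iM i))); split => //.
  by rewrite node0 nodeL // ltn_mod.
move=> _ [lam [l [/andP[lam0 lamL] Fl ->]]]; have [i ci] := cP l Fl.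
set j := Num.truncn (lam * D2 / v).
have ld0 : 0 <= lam * D2 / v by exact: divr_ge0 (mulr_ge0 lam0 D20) (ltW v0).
have jM : (j < M)%N.
  rewrite ltnS /j; apply: le_truncn; rewrite ler_pM2r ?invr_gt0 //.
  by rewrite ler_wpM2r.
have jlam : `|lam - node j| * D2 <= v.
  have [D2E|D2n] := eqVneq D2 0; first by rewrite D2E mulr0 ltW.
  have D2p : 0 < D2 by rewrite lt_neqAle eq_sym D2n.
  rewrite -[X in _ * X](ger0_norm D20) -normrM mulrBl /node divfK // ler_norml.
  have := ld0; rewrite -truncn_le -/j ler_pdivlMr // => h1.
  have := truncnS_gt (lam * D2 / v); rewrite -/j ltr_pdivrMr // -natr1 => h2.
  by lra.
have kM : (i * M + j < n * M)%N.
  apply: (@leq_trans (i.+1 * M)%N); first by rewrite mulSn addnC ltn_add2r.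
  by rewrite leq_mul2r ltn_ord orbT.
exists (Ordinal kM) => x.
have -> : c (Ordinal (iM (Ordinal kM))) = c i.
  by congr c; apply: val_inj; rewrite /= divnMDl // divn_small // addn0.
rewrite /= modnMDl modn_small // mulr_natl mulr2n.
have jl : (node j - lam) * D2 <= v /\ (lam - node j) * D2 <= v.
  split; apply: le_trans jlam; rewrite ler_wpM2r //; last exact: ler_norm.
  by rewrite distrC ler_norm.
rewrite ler_norml; apply/andP; split.
  rewrite lerNl opprB; apply: (@dual_loss_perturb _ _ _ _ hpolish hdiam B) => //;
    [exact: FB| |exact: jl.2|exact: ltW].
  by move=> y; rewrite (le_trans (ler_norm _)) // distrC.
apply: (@dual_loss_perturb _ _ _ _ hpolish hdiam B) => //;
  [exact: FB| |exact: jl.1|exact: ltW].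
by move=> y; rewrite (le_trans (ler_norm _)).
Qed.

End DualClass.

(** * Numerical sums behind the constants *)

Section Constants.
Context {R : realType}.

Lemma half_pow_small (e : R) : 0 < e -> exists K : nat, 2^-1 ^+ K <= e.
Proof.
move=> e0; pose K := (Num.truncn e^-1).+1; exists K.
have h : e^-1 <= 2 ^+ K.
  apply: (@le_trans _ _ K%:R); first exact: ltW (truncnS_gt _).
  by rewrite -natrX ler_nat ltnW // ltn_expl.
by rewrite exprVn -[e]invrK lef_pV2 // posrE ?invr_gt0 // exprn_gt0.
Qed.

(** What the grid of multipliers adds to an entropy sum at scale [v], with [x] standing for
    [Lam * diam d ^+ 2]. *)
Definition grid_entropy (x v : R) : R :=
  v * Num.sqrt (ln (Num.truncn (x / v)).+1%:R).

Lemma grid_entropy_le (x v : R) : 0 <= x -> 0 < v ->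
  grid_entropy x v <= if v <= x then Num.sqrt (x * v) else 0.
Proof.
move=> x0 v0; rewrite /grid_entropy; case: ifPn => [vx|].
  rewrite {1}(_ : v = Num.sqrt (v ^+ 2)); last by rewrite sqrtr_sqr gtr0_norm.
  rewrite -sqrtrM ?sqr_ge0 //.
  rewrite ler_wsqrtr //.
  have -> : x * v = v ^+ 2 * (x / v) by field; rewrite gt_eqF.
  rewrite ler_pM2l ?exprn_gt0 // -natr1.
  have xv0 : 0 <= x / v by rewrite divr_ge0 // ltW.
  rewrite -truncn_le in xv0; apply: le_trans xv0; rewrite addrC; apply: le_ln1Dx.
  by rewrite (lt_le_trans _ (ler0n _ _)) // ltrN10.
rewrite -ltNge => xv; rewrite (_ : Num.truncn _ = 0%N) ?ln1 ?sqrtr0 ?mulr0 //.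
by apply: truncn_def; rewrite divr_ge0 ?(ltW v0) //= ltr_pdivrMr ?mul1r.
Qed.

Lemma grid_entropy_le_range (x v : R) : 0 <= x -> 0 < v ->
  grid_entropy x v <= x.
Proof.
move=> x0 v0; apply: (le_trans (grid_entropy_le x0 v0)); case: ifPn => // vx.
rewrite [leRHS](_ : x = Num.sqrt (x ^+ 2)); last by rewrite sqrtr_sqr ger0_norm.
by rewrite ler_wsqrtr // expr2 ler_wpM2l.
Qed.

Lemma sum_grid_entropy_le (x v : R) (K : nat) : 0 <= x -> 0 < v ->
  \sum_(k < K) grid_entropy x (v * 2^-1 ^+ k) <= 7 / 2 * x.
Proof.
move=> x0 v0; set T := \sum_(_ < _) _.
(* The second bound carries the induction while [v <= x]: halving [v] shrinks the root by at most
   [5/7], and [1 + 7/2 * 5/7 = 7/2]. For [v > x] the head vanishes and the first bound passes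
   through. *)
suff : T <= 7 / 2 * x /\ T <= 7 / 2 * Num.sqrt (x * v) by case.
rewrite {}/T; elim: K v v0 => [|K IH] v v0.
  by rewrite big_ord0 !mulr_ge0 ?sqrtr_ge0.
rewrite big_ord_recl expr0 mulr1 (eq_bigr (fun k : 'I_K =>
    grid_entropy x (v / 2 * 2^-1 ^+ k))); last first.
  by move=> k _; rewrite lift0 exprS mulrA.
have [h1 h2] := IH (v / 2) ltac:(by rewrite divr_gt0).
have := grid_entropy_le x0 v0; case: ifPn => [vx|]; last first.
  rewrite -ltNge => xv hg.
  have : x <= Num.sqrt (x * v).
    rewrite [leLHS](_ : x = Num.sqrt (x ^+ 2)); last by rewrite sqrtr_sqr ger0_norm.
    rewrite ler_wsqrtr //.
    by rewrite expr2 ler_wpM2l // ltW.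
  by split; lra.
move=> hg; have g0 := sqrtr_ge0 (x * v).
have sx : Num.sqrt (x * v) <= x.
  rewrite [leRHS](_ : x = Num.sqrt (x ^+ 2)); last by rewrite sqrtr_sqr ger0_norm.
  rewrite ler_wsqrtr //.
  by rewrite expr2 ler_wpM2l.
have s2 : Num.sqrt (x * (v / 2)) <= 5 / 7 * Num.sqrt (x * v).
  have c0 : (0 : R) <= 5 / 7 by lra.
  rewrite [5 / 7](_ : _ = Num.sqrt ((5 / 7) ^+ 2)); last by rewrite sqrtr_sqr ger0_norm.
  rewrite -sqrtrM ?sqr_ge0 //.
  rewrite ler_wsqrtr //; have := mulr_ge0 x0 (ltW v0); lra.
by split; lra.
Qed.

(* Chosen so that [chain_weight k ^+ 2 >= k + 2], which makes the union bound
   over the levels summable, while the weighted sums over the levels stay below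
   the constant 2 of the theorem. *)
Definition chain_weight (k : nat) : R :=
  if k is k'.+1 then 7 / 4 * (6 / 5) ^+ k' else 17 / 12.

Lemma chain_weight_ge0 k : 0 <= chain_weight k.
Proof. by case: k => [|k] /=; rewrite ?mulr_ge0 ?exprn_ge0 //; lra. Qed.

(** Nearly tight at [k = 1], where [49/16] must exceed [3]; from there the factor [36/25] adds at
    least [3 * 11/25 > 1] per level. *)
Lemma chain_weight_sqr k : k.+2%:R <= chain_weight k ^+ 2.
Proof.
case: k => [|k] /=; first by rewrite expr2; lra.
rewrite exprMn -exprM mulnC exprM.
have -> : (6 / 5 : R) ^+ 2 = 36 / 25 by field.
have -> : (7 / 4 : R) ^+ 2 = 49 / 16 by field.
have e m : m.+2%:R = m%:R + 2 :> R by rewrite -addn2 natrD.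
elim: k => [|k]; first by rewrite expr0; lra.
rewrite exprS (e k.+1) (e k.+2) (e k) -(natr1 k).
set y := _ ^+ k; have k0 : (0 : R) <= k%:R by [].
lra.
Qed.

(** Halving against growth by [6/5] leaves the ratio [3/5], and [7/4 * 5/2 = 35/8]. *)
Lemma sum_chain_weight_le (K : nat) :
  \sum_(k < K) 2^-1 ^+ k * chain_weight k.+1 <= 35 / 8.
Proof.
rewrite (eq_bigr (fun k : 'I_K => 7 / 4 * (3 / 5) ^+ k)); last first.
  move=> k _ /=; rewrite mulrCA -exprMn; congr (_ * _ ^+ _); lra.
rewrite -mulr_sumr.
have -> : \sum_(k < K) (3 / 5 : R) ^+ k = 5 / 2 * (1 - (3 / 5) ^+ K).
  elim: K => [|K IH]; first by rewrite big_ord0 expr0 subrr mulr0.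
  by rewrite big_ord_recr /= IH exprS; lra.
have : (0 : R) <= (3 / 5) ^+ K by rewrite exprn_ge0 //; lra.
lra.
Qed.

End Constants.

(** * Uniform deviation of the dual losses *)

Section DualDeviation.
Context {R : realType} {dZ : measure_display} {Z : measurableType dZ}.
Variable d : Z -> Z -> R.
Hypothesis hpolish : polish_metric d.
Hypothesis hborel : @measurable _ Z = <<s [set A | d_open d A] >>.
Hypothesis hdiam : finite_diam d.
Context {dO : measure_display} {Om : measurableType dO}.
Variables (Q : probability Om R) (P : probability Z R).
Variables (N : nat) (z : 'I_N -> Om -> Z).
Hypothesis N0 : (0 < N)%N.
Hypothesis iid : iid_sample Q P z.

Lemma dual_class_deviation (F : set (Z -> R)) (B Lam eta : R) :
  F !=set0 -> (forall l, F l -> forall x, 0 <= l x <= B) -> 0 < B -> 0 <= Lam ->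
  (dudley_integral F < +oo)%E -> 0 < eta < 1 ->
  exists E : set Om, [/\ measurable E, (Q (~` E) <= (eta / 2)%:E)%E &
    forall w, E w -> forall f, dual_class d F Lam f -> deviation P z w f <=
      48 * fine (dudley_integral F) / Num.sqrt N%:R +
      48 * (Lam * diam d ^+ 2) / Num.sqrt N%:R +
      2 * B * Num.sqrt (ln (2 / eta) / (2 * N%:R))].
Proof.
move=> F0 FB B0 Lam0 Jfin /andP[eta0 eta1].
set J := fine _; set x := Lam * _; set u := ln (2 / eta).
have x0 : 0 <= x by rewrite mulr_ge0 ?sqr_ge0.
have u0 : 0 < u by rewrite ln_gt0 // ltr_pdivlMr // mul1r (lt_trans eta1) // ltr1n.
have Nr : (0 : R) < N%:R by rewrite ltr0n.
set r := Num.sqrt u; have r0 : 0 < r by rewrite sqrtr_gt0.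
pose s : R := Num.sqrt (2 * N%:R)^-1.
have s0 : 0 < s by rewrite sqrtr_gt0 invr_gt0 mulr_gt0.
pose v k : R := B / 32 * 2^-1 ^+ k.
have v0 k : 0 < v k by rewrite /v mulr_gt0 ?exprn_gt0 ?divr_gt0.
have vS k : v k.+1 = v k / 2 by rewrite /v exprS; ring.
pose cov k := cid (dudley_finite_cover F0 Jfin (v0 k)).
pose n k := projT1 (cov k).
have [ncov n0 nE] : [/\ forall k, has_cover F (v k) (n k), forall k, (0 < n k)%N &
    forall k, entropy_integrand F (v k) = (Num.sqrt (ln (n k)%:R))%:E].
  by split=> k; case: (projT2 (cov k)).
pose a k : R := Num.sqrt (ln (n k)%:R).
pose M k := (Num.truncn (x / v k)).+1.
pose b k : R := Num.sqrt (ln (M k)%:R).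
(* One summand per source: [a k] cancels the cover of [F], [b k] cancels the grid, and the last
   leaves at most [(eta / 2) ^+ k.+2], summable over the levels. *)
pose q k : R := a k + b k + chain_weight k * r.
have a0 k : 0 <= a k by exact: sqrtr_ge0.
have b0 k : 0 <= b k by exact: sqrtr_ge0.
have cw0 k : 0 <= chain_weight k :> R by exact: chain_weight_ge0.
have q0 k : 0 <= q k by rewrite /q !addr_ge0 ?mulr_ge0 ?(ltW r0).
pose p k : R := eta / 2 * 2^-1 ^+ k.+1.
have lnX (m : nat) : (0 < m)%N -> m%:R * expR (- Num.sqrt (ln m%:R) ^+ 2) = 1 :> R.
  move=> m0; have m1 : (0 : R) < m%:R by rewrite ltr0n.
  by rewrite sqr_sqrtr ?ln_ge0 ?ler1n // expRN lnK ?posrE // divff // gt_eqF.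
have mp k : (n k * M k)%N%:R * expR (- q k ^+ 2) <= p k.
  apply: (@le_trans _ _ ((n k)%:R * expR (- a k ^+ 2) * ((M k)%:R * expR (- b k ^+ 2))
      * expR (- (chain_weight k ^+ 2 * u)))).
    rewrite [leRHS](_ : _ = (n k * M k)%N%:R *
        expR (- (a k ^+ 2 + b k ^+ 2 + chain_weight k ^+ 2 * u))); last first.
      by rewrite natrM !opprD !expRD; ring.
    rewrite ler_wpM2l // ler_expR lerN2 /q -[u in leLHS]sqr_sqrtr ?(ltW u0) // -/r.
    have := mulr_ge0 (a0 k) (b0 k).
    have := mulr_ge0 (cw0 k) (ltW r0); set y := _ * r => y0.
    have := mulr_ge0 (a0 k) y0; have := mulr_ge0 (b0 k) y0.
    have -> : chain_weight k ^+ 2 * r ^+ 2 = y ^+ 2 by rewrite -exprMn.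
    lra.
  rewrite !lnX // !mul1r.
  apply: (@le_trans _ _ (expR (- (k.+2%:R * u)))).
    by rewrite ler_expR lerN2 ler_wpM2r ?(ltW u0) // chain_weight_sqr.
  rewrite -mulrN expRM_natl expRN lnK ?posrE ?divr_gt0 // invf_div exprS /p.
  rewrite ler_wpM2l ?divr_ge0 ?(ltW eta0) //.
  by rewrite ler_pXn2r ?nnegrE ?divr_ge0 ?(ltW eta0) //; lra.
(* The residual of the chaining must fit in the slack [2 - 17/12 - 35/64], which exceeds [1/30]. *)
have [K KP] : exists K : nat, 4 * v K <= B * r * s / 30.
  have [K KP] := @half_pow_small R (r * s * (8 / 30)) ltac:(by rewrite !mulr_gt0).
  exists K; rewrite /v; have := ler_wpM2l (ltW B0) KP; lra.
have GB f : dual_class d F Lam f -> measurable_fun setT f /\ forall x, 0 <= f x <= B.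
  move=> [lam [l [/andP[lam0 _] Fl ->]]]; split.
    by have [] := bounded_mfun_dual_loss hpolish hborel hdiam (FB _ Fl) lam0.
  by move=> y; exact: (dual_loss_range hpolish (FB _ Fl)).
have [||||E [mE QE EP]] := @chaining _ _ _ _ _ Q P N z N0 iid
    (dual_class d F Lam) B (fun k => 2 * v k) q p (fun k => (n k * M k)%N) K (ltW B0) GB.
- by move=> k; exact: (has_cover_dual_class hpolish hdiam FB Lam0 (v0 k) (ncov k)).
- by move=> k; rewrite mulr_ge0 // ltW.
- by [].
- exact: mp.
exists E; split => //.
  apply: (le_trans QE); rewrite lee_fin /p -mulr_sumr ler_piMr ?divr_ge0 ?(ltW eta0) //.
  have -> : \sum_(k < K.+1) 2^-1 ^+ k.+1 = 1 - 2^-1 ^+ K.+1 :> R.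
    elim: K.+1 => [|m IH]; first by rewrite big_ord0 expr0 subrr.
    by rewrite big_ord_recr /= IH [in RHS]exprS [X in _ + X]exprS; lra.
  by rewrite gerBl exprn_ge0.
move=> w Ew f Gf; apply: (le_trans (EP _ Ew _ Gf)).
pose t : R := (Num.sqrt N%:R)^-1.
have t0 : 0 < t by rewrite invr_gt0 sqrtr_gt0.
(* [4/5] exceeds sqrt (1/2) and turns the factor 60 of [hB] into exactly 48. *)
have st : s <= 4 / 5 * t.
  have c0 : (0 : R) <= 4 / 5 by lra.
  rewrite /t -sqrtrV // [4 / 5](_ : _ = Num.sqrt ((4 / 5) ^+ 2)); last first.
    by rewrite sqrtr_sqr ger0_norm.
  rewrite -sqrtrM ?sqr_ge0 // ler_wsqrtr // invfM.
  have : (0 : R) < N%:R^-1 by rewrite invr_gt0.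
  lra.
have -> : Num.sqrt (u / (2 * N%:R)) = r * s by rewrite sqrtrM ?(ltW u0).
have JE : dudley_integral F = J%:E.
  rewrite /J fineK // ge0_fin_numE //.
  by apply: integral_ge0 => y _; exact: entropy_integrand_ge0.
(* Level 0 costs [32 * J] because [B = 32 * v 0]; the links cost [16 * J] because
   [4 * v k = 16 * (v k.+1 - v k.+2)]. *)
have hA : B * a 0%N + \sum_(k < K) 4 * v k * a k.+1 <= 48 * J.
  have h1 : v 0%N * a 0%N <= J.
    by rewrite -lee_fin -JE; apply: first_entropy_le_dudley => //; rewrite nE.
  have : \sum_(k < K) (v k.+1 - v k.+2) * a k.+1 <= J.
    rewrite -lee_fin -JE.
    apply: (@sum_entropy_le_dudley _ _ _ F0 (fun k => v k.+1) (fun k => a k.+1)) => //.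
    - by move=> k; exact: ltW.
    - by move=> k; rewrite (vS k.+1) ler_pdivrMr // ler_pMr // ler1n.
    - by move=> k _; rewrite nE.
  have -> : \sum_(k < K) 4 * v k * a k.+1 =
      16 * \sum_(k < K) (v k.+1 - v k.+2) * a k.+1.
    by rewrite mulr_sumr; apply: eq_bigr => k _; rewrite !vS; field.
  have -> : B = 32 * v 0%N by rewrite /v expr0; field.
  lra.
(* Level 0 costs [32 * x], the links [8 * (7 / 2) * x = 28 * x]. *)
have hB : B * b 0%N + \sum_(k < K) 4 * v k * b k.+1 <= 60 * x.
  have h1 := grid_entropy_le_range x0 (v0 0%N).
  have h2 := @sum_grid_entropy_le R x (v 1%N) K x0 (v0 1%N).
  have -> : \sum_(k < K) 4 * v k * b k.+1 =
      8 * \sum_(k < K) grid_entropy x (v 1%N * 2^-1 ^+ k).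
    rewrite mulr_sumr; apply: eq_bigr => k _.
    have -> : v 1%N * 2^-1 ^+ k = v k.+1 by rewrite /v expr1 exprS; ring.
    by rewrite /grid_entropy /b /M [in LHS](_ : v k = 2 * v k.+1) ?vS; field.
  have -> : B * b 0%N = 32 * grid_entropy x (v 0%N).
    by rewrite /grid_entropy /b /M {1}(_ : B = 32 * v 0%N) ?mulrA // /v expr0; field.
  lra.
have hC : B * chain_weight 0 + \sum_(k < K) 4 * v k * chain_weight k.+1 <=
    B * (17 / 12 + 35 / 64).
  have -> : \sum_(k < K) 4 * v k * chain_weight k.+1 =
      B / 8 * \sum_(k < K) 2^-1 ^+ k * chain_weight k.+1 :> R.
    by rewrite mulr_sumr; apply: eq_bigr => k _; rewrite /v; field.
  have B8 : 0 <= B / 8 by rewrite divr_ge0 // ltW.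
  have := ler_wpM2l B8 (sum_chain_weight_le K); rewrite /chain_weight; lra.
have -> : \sum_(k < K) 2 * (2 * v k) * q k.+1 * s =
    (\sum_(k < K) 4 * v k * a k.+1 + \sum_(k < K) 4 * v k * b k.+1 +
     (\sum_(k < K) 4 * v k * chain_weight k.+1) * r) * s.
  rewrite [X in _ + X]mulr_suml -!big_split /= mulr_suml.
  by apply: eq_bigr => k _; rewrite /q /=; ring.
rewrite {1}/q -/s.
move: hA hB hC; set SA := \sum_(_ < _) _; set SB := \sum_(_ < _) _.
set SC := \sum_(_ < _) _ => hA hB hC.
have J0 : 0 <= J.
  rewrite -lee_fin -JE; apply: integral_ge0 => y _.
  exact: entropy_integrand_ge0.
have k1 := ler_wpM2r (ltW s0) hA; have k2 := ler_wpM2r (ltW s0) hB.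
have k3 := ler_wpM2r (ltW (mulr_gt0 r0 s0)) hC.
have k4 := ler_wpM2l J0 st; have k5 := ler_wpM2l x0 st.
have k6 := mulr_ge0 (ltW B0) (ltW (mulr_gt0 r0 s0)).
have k7 := mulr_ge0 J0 (ltW t0).
have -> : 48 * J / Num.sqrt N%:R = 48 * J * t by [].
have -> : 48 * x / Num.sqrt N%:R = 48 * x * t by [].
lra.
Qed.

End DualDeviation.

(** [empirical] is a bare set function, whereas duality speaks of probability measures. Appending
    one point to [N.+1] points is a mixture with weight [1 / N.+2] on its Dirac mass. *)
Lemma empirical_probability {R : realType} {dZ : measure_display}
    {Z : measurableType dZ} (N : nat) (x : 'I_N -> Z) : (0 < N)%N ->
  exists nu : probability Z R, (nu : set Z -> \bar R) = empirical x /\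
    forall f, bounded_mfun f -> mean nu f = N%:R^-1 * \sum_(i < N) f (x i).
Proof.
have mdirac (y : Z) (f : Z -> R) : bounded_mfun f ->
    mean (@dirac _ Z y R) f = f y.
  move=> [mf _]; rewrite /mean /Rintegral integral_dirac //.
    by rewrite diracT mul1e.
  exact/measurable_EFinP.
case: N x => // N x _; elim: N x => [|N IH] x.
  exists (@dirac _ Z (x ord0) R); split.
    by apply/funext => A; rewrite /empirical invr1 mul1r big_ord1 /dirac.
  by move=> f bf; rewrite mdirac // invr1 mul1r big_ord1.
have [nu [nuE nuM]] := IH (fun i => x (widen_ord (leqnSn _) i)).
pose t : R := N.+1%:R / N.+2%:R.
have N1 : (0 : R) < N.+1%:R by [].
have N2 : (0 : R) < N.+2%:R by [].
have N12 : N.+2%:R = N.+1%:R + 1 :> R by rewrite natr1.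
have t01 : 0 <= t <= 1.
  by rewrite /t divr_ge0 //= ler_pdivrMr // mul1r ler_nat.
have tE (y S : R) : t * (N.+1%:R^-1 * S) + (1 - t) * y = N.+2%:R^-1 * (S + y).
  have -> : 1 - t = N.+2%:R^-1.
    by apply: (mulIf (lt0r_neq0 N2)); rewrite mulrBl divfK ?mulVf ?gt_eqF // N12; ring.
  by rewrite /t; field; rewrite !gt_eqF.
have [m [mE mM]] := probability_mixture t01 nu (@dirac _ Z (x ord_max) R).
exists m; split.
  apply/funext => A; rewrite mE nuE /empirical /dirac -!EFinM -EFinD tE.
  by rewrite [in RHS]big_ord_recr.
by move=> f bf; rewrite mM // nuM // mdirac // tE [in RHS]big_ord_recr.
Qed.

Theorem theorem4 (R : realType)
  (dZ : measure_display) (Z : measurableType dZ) (d : Z -> Z -> R)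
  (hpolish : polish_metric d)
  (hborel : @measurable _ Z = <<s [set A | d_open d A] >>)
  (hdiam : finite_diam d)
  (F : set (Z -> R)) (B L alpha : R)
  (hbound : forall l, F l -> forall x, 0 <= l x <= B)
  (husc : forall l, F l -> usc d l)
  (hlip : forall l, F l -> forall z z', l z' - l z <= L * d z z')
  (hJ : (dudley_integral F < +oo)%E)
  (halpha : 0 < alpha)
  (P : probability Z R)
  (dO : measure_display) (Om : measurableType dO) (Pr : probability Om R)
  (N : nat) (hN : (0 < N)%N) (z : 'I_N -> Om -> Z)
  (hiid : iid_sample Pr P z)
  (lhat : Om -> (Z -> R))
  (hlhat : forall w, F (lhat w) /\
     forall l, F l -> (dro_risk d (empirical (fun i => z i w)) alpha (lhat w)
                       <= dro_risk d (empirical (fun i => z i w)) alpha l)%E)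
  (hattained : exists2 lstar, F lstar &
     dro_risk d P alpha lstar = ereal_inf [set dro_risk d P alpha l | l in F]) :
  forall eta : R, 0 < eta < 1 ->
  exists2 E : set Om, measurable E /\ (Pr E >= (1 - eta)%:E)%E &
    forall w, E w ->
      (dro_risk d P alpha (lhat w) - ereal_inf [set dro_risk d P alpha l | l in F]
       <= (48 * fine (dudley_integral F) / Num.sqrt N%:R
           + 48 * L * (diam d) ^+ 2 / (alpha * Num.sqrt N%:R)
           + 3 * B * Num.sqrt (ln (2 / eta) / (2 * N%:R)))%:E)%E.
Proof.
move=> eta /andP[eta0 eta1]; have [lstar Fstar <-] := hattained.
have dge0 x y : 0 <= d x y by case: hpolish => -[].
have dC x y : d x y = d y x by case: hpolish => -[_ [_ []]].
have B0 : 0 <= B by have /andP[] := hbound _ Fstar point; exact: le_trans.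
(* The sign of [L] is not prescribed. A negative [L] forces all distances to vanish, so replacing it
   by [0] leaves [L * diam d ^+ 2] unchanged. *)
pose L' := Num.max L 0.
have L'0 : 0 <= L' by rewrite le_max lexx orbT.
have LD : L * diam d ^+ 2 = L' * diam d ^+ 2.
  rewrite /L'; case: (leP L 0) => // L0; rewrite mul0r.
  have [->|Ln0] := eqVneq L 0; first by rewrite mul0r.
  have {Ln0}L0 : L < 0 by rewrite lt_neqAle Ln0.
  suff -> : diam d = 0 by rewrite expr0n mulr0.
  apply/le_anti/andP; split; last exact: diam_ge0.
  apply: ge_sup; first by exists (d point point), (point, point).
  move=> _ [[x y] _ <-] /=; have := hlip _ Fstar x y; have := hlip _ Fstar y x.
  by rewrite dC => h1 h2; rewrite -(nmulr_rge0 _ L0); lra.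
have lipL' l : F l -> forall x y, l y - l x <= L' * d x y.
  move=> Fl x y; apply: (le_trans (hlip _ Fl x y)).
  by rewrite ler_wpM2r // le_max lexx.
have ml l : F l -> measurable_fun setT l.
  move=> Fl; apply: (@lipschitz_measurable _ _ _ d hpolish hborel _ L') => x y.
  by rewrite dC; exact: lipL'.
have weak mu l lam (Fl : F l) lam0 := @dro_risk_weak_duality R dZ Z d hpolish hborel hdiam
  mu alpha lam B l (hbound _ Fl) (ml _ Fl) lam0.
have strong mu l (Fl : F l) := @dro_risk_strong_duality R dZ Z d hpolish hborel hdiam
  mu alpha B L' l (hbound _ Fl) L'0 (lipL' _ Fl) halpha.
have [lams /andP[lams0 lamsL] hs] := strong P lstar Fstar.
set u := ln (2 / eta).
have u0 : 0 < u by rewrite ln_gt0 // ltr_pdivlMr // mul1r (lt_trans eta1) // ltr1n.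
have Nr : (0 : R) < N%:R by rewrite ltr0n.
have Lam0 : 0 <= L' / alpha by rewrite divr_ge0 // ltW.
have -> : 48 * L * diam d ^+ 2 / (alpha * Num.sqrt N%:R) =
    48 * (L' / alpha * diam d ^+ 2) / Num.sqrt N%:R.
  rewrite -(mulrA 48 L) LD; field.
  by rewrite !gt_eqF // sqrtr_gt0.
(* The chaining scales start at [B / 32], which must be positive; for [B = 0] all losses vanish and
   so does the excess risk. *)
have [B00|Bn0] := eqVneq B 0.
  have F00 l : F l -> l = fun=> 0.
    move=> Fl; apply/funext => x; apply/le_anti; rewrite andbC.
    by have := hbound _ Fl x; rewrite B00.
  exists setT; first by split => //; rewrite probability_setT lee_fin lerBlDr lerDl ltW.
  move=> w _; rewrite (F00 _ (hlhat w).1) -(F00 _ Fstar) subee; last first.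
    rewrite fin_numElt (lt_le_trans (ltNyr _) hs) /=.
    exact: le_lt_trans (weak P _ _ Fstar lams0) (ltry _).
  rewrite lee_fin B00 mulr0 mul0r addr0.
  have J0 : 0 <= fine (dudley_integral F).
    by apply: fine_ge0; apply: integral_ge0 => v _; apply: entropy_integrand_ge0; exists lstar.
  apply: addr_ge0; apply: divr_ge0; rewrite ?sqrtr_ge0 //; apply: mulr_ge0 => //.
  by apply: mulr_ge0 => //; exact: sqr_ge0.
have {Bn0}B0' : 0 < B by rewrite lt_neqAle eq_sym Bn0.
have F0 : F !=set0 by exists lstar.
have [|E1 [mE1 QE1 E1P]] := @dual_class_deviation R dZ Z d hpolish hborel hdiam dO Om
  Pr P N z hN hiid F B (L' / alpha) eta F0 hbound B0' Lam0 hJ.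
  by rewrite eta0.
(* Its multiplier is optimal under [P], so this function is not random: one Hoeffding bound at level
   [eta / 2] suffices and supplies the third [B]. *)
pose phis := dual_loss d lams lstar.
have bphis : bounded_mfun phis.
  exact: bounded_mfun_dual_loss hpolish hborel hdiam _ _ (hbound _ Fstar) _ lams0.
have [||E2 [mE2 QE2 E2P]] := @deviation_family R dO Om dZ Z Pr P N z hN hiid 1
    (fun _ x => - phis x) B (Num.sqrt u) B0 (sqrtr_ge0 _).
- by move=> _; exact: bounded_mfunN.
- move=> _; exists (- B) => x.
  have := dual_loss_range hpolish (hbound _ Fstar) x lams0; rewrite -/phis; lra.
have {}QE2 : (Pr (~` E2) <= (eta / 2)%:E)%E.
  apply: (le_trans QE2); rewrite lee_fin mul1r sqr_sqrtr ?(ltW u0) // expRN.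
  by rewrite lnK ?posrE ?divr_gt0 // invf_div.
exists (E1 `&` E2).
  split; first exact: measurableI.
  have mE : measurable (E1 `&` E2) by exact: measurableI.
  have : (Pr (~` (E1 `&` E2)) <= (eta / 2)%:E + (eta / 2)%:E)%E.
    rewrite setCI; apply: le_trans (leeD QE1 QE2).
    by apply: measureU2; exact: measurableC.
  rewrite probability_setC // -EFinD -splitr.
  rewrite -[Pr (E1 `&` E2)]fineK ?fin_num_measure // -EFinB !lee_fin; lra.
move=> w [E1w E2w].
have [nu [nuE nuM]] := @empirical_probability R dZ Z N (fun i => z i w) hN.
have [Fw hw] := hlhat w.
have [lamw /andP[lamw0 lamwL] hsw] := strong nu (lhat w) Fw.
have bphiw := bounded_mfun_dual_loss hpolish hborel hdiam (hbound _ Fw) lamw0.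
have h1 := weak P (lhat w) lamw Fw lamw0.
(* Empirical optimality passes through duality at [nu]: strong for [lhat w], weak for [lstar] with
   the multiplier [lams] chosen under [P]. *)
have h2 : lamw * alpha ^+ 2 + mean nu (dual_loss d lamw (lhat w)) <=
    lams * alpha ^+ 2 + mean nu phis.
  rewrite -lee_fin; apply: (le_trans hsw); apply: le_trans (weak nu _ _ Fstar lams0).
  by rewrite nuE; exact: hw.
have Gw : dual_class d F (L' / alpha) (dual_loss d lamw (lhat w)).
  by exists lamw, (lhat w); rewrite lamw0.
have h3 := E1P w E1w _ Gw.
have h4 := E2P w E2w ord0.
rewrite deviationN // -mulrA in h4.
(* Under [P] the roles are exchanged: weak duality for [lhat w], strong for [lstar]. Adding [h2]
   cancels the multiplier terms and leaves two deviations. *)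
apply: (le_trans (leeB h1 hs)); rewrite -EFinB lee_fin.
have nuS f : bounded_mfun f -> mean nu f = sample_mean z w f by exact: nuM.
rewrite !nuS // in h2; move: h2 h3 h4.
rewrite /deviation -/u sqrtrM ?(ltW u0) // -/phis.
set c := Num.sqrt u * _. lra.
Qed.
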